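(* For each $1\le n\le\omega$ and every comeager set $C\subseteq X_n$, $F_n\le_B F_n\restriction C$.
   Context: Let $\mathbb N=\{0,1,2,\dots\}$ and identify $2^{\mathbb N}$ with $\mathcal P(\mathbb N)$. For $1\le m\le\omega$ and $x\in((2^{\mathbb N})^{\mathbb N})^m$ define recursively: $A^x_1=\{x(0)(k):k\in\mathbb N\}\subseteq 2^{\mathbb N}$; for $1\le j<m$ and $l\in\mathbb N$, $a^{x,l}_1=\{x(0)(k):x(1)(l)(k)=1\}$ and $a^{x,l}_{j}=\{a^{x,k}_{j-1}:x(j)(l)(k)=1\}$ for $j\ge 2$; and $A^x_{j+1}=\{a^{x,k}_j:k\in\mathbb N\}$ for $1\le j<m$. Let $X_1=(2^{\mathbb N})^{\mathbb N}$, and for $2\le n\le\omega$ let $X_n$ be the set of $x\in((2^{\mathbb N})^{\mathbb N})^n$ such that for every $1\le i<n$: (1) for every $m$ there is $k$ with $x(i)(k)(m)=1$; (2) for every $k$ there is $m$ with $x(i)(k)(m)=1$; (3) for all $k,l_1,l_2$, if $x(i-1)(l_1)=x(i-1)(l_2)$ then $x(i)(k)(l_1)=x(i)(k)(l_2)$. For $1\le n<\omega$, $F_n$ on $X_n$ is $x\mathrel{F_n}y\iff A^x_n=A^y_n$; $F_\omega$ on $X_\omega$ is $x\mathrel{F_\omega}y\iff A^x_j=A^y_j$ for all $1\le j<\omega$. *)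

(* Defs.v *)
From Stdlib Require Import Arith.

Inductive lenat : Type := Fin (m : nat) | Omega.

Definition lt_ln (i : nat) (n : lenat) : Prop :=
  match n with Fin m => i < m | Omega => True end.

(* The ambient space: x i k m = x(i)(k)(m).  A point of ((2^N)^N)^n is encoded
   by padding with zeros all coordinates i >= n. *)
Definition Pt : Type := nat -> nat -> nat -> bool.

Fixpoint Rk (j : nat) : Type :=
  match j with 0 => (nat -> bool) | S j' => Rk j' -> Prop end.

(* aa x j l = a^{x,l}_{j+1} *)
Fixpoint aa (x : Pt) (j : nat) (l : nat) : Rk (S j) :=
  match j as j0 return Rk (S j0) with
  | 0 => fun r : nat -> bool => exists k, x 1 l k = true /\ r = x 0 k
  | S j' => fun s : Rk (S j') => exists k, x (S (S j')) l k = true /\ s = aa x j' k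
  end.

(* AA x j = A^x_{j+1} *)
Definition AA (x : Pt) (j : nat) : Rk (S j) :=
  match j as j0 return Rk (S j0) with
  | 0 => fun r : nat -> bool => exists k, r = x 0 k
  | S j' => fun s : Rk (S j') => exists k, s = aa x j' k
  end.

Definition inX (n : lenat) (x : Pt) : Prop :=
  (forall i, ~ lt_ln i n -> forall k m, x i k m = false) /\
  (forall i, 1 <= i -> lt_ln i n ->
     (forall m, exists k, x i k m = true) /\
     (forall k, exists m, x i k m = true) /\
     (forall k l1 l2, x (i - 1) l1 = x (i - 1) l2 -> x i k l1 = x i k l2)).

Definition F (n : lenat) (x y : Pt) : Prop :=
  match n with
  | Fin m => AA x (m - 1) = AA y (m - 1)
  | Omega => forall j, AA x j = AA y j
  end.

Definition is_open (U : Pt -> Prop) : Prop :=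
  forall x, U x -> exists N, forall y,
    (forall i k m, i < N -> k < N -> m < N -> y i k m = x i k m) -> U y.

Inductive borel : (Pt -> Prop) -> Prop :=
  | borel_open U : is_open U -> borel U
  | borel_compl B : borel B -> borel (fun x => ~ B x)
  | borel_union (Bs : nat -> Pt -> Prop) :
      (forall k, borel (Bs k)) -> borel (fun x => exists k, Bs k x).

Definition dense_in (S D : Pt -> Prop) : Prop :=
  forall U, is_open U -> (exists x, S x /\ U x) -> exists x, S x /\ U x /\ D x.

Definition comeager_in (S C : Pt -> Prop) : Prop :=
  exists Us : nat -> Pt -> Prop,
    (forall k, is_open (Us k) /\ dense_in S (Us k)) /\
    (forall x, S x -> (forall k, Us k x) -> C x).

(* f is Borel measurable as a map from the subspace S (with its Borel
   sigma-algebra = traces of Borel sets) into Pt. *)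
Definition borel_on (S : Pt -> Prop) (f : Pt -> Pt) : Prop :=
  forall B, borel B -> exists B', borel B' /\ forall x, S x -> (B (f x) <-> B' x).

Definition borel_reducible (S : Pt -> Prop) (E : Pt -> Pt -> Prop)
    (T : Pt -> Prop) (E' : Pt -> Pt -> Prop) : Prop :=
  exists f : Pt -> Pt,
    (forall x, S x -> T (f x)) /\ borel_on S f /\
    (forall x y, S x -> S y -> (E x y <-> E' (f x) (f y))).

(* Main.v *)
From Stdlib Require Import Arith Lia List Bool Classical ClassicalEpsilon.
From Stdlib Require Import FunctionalExtensionality PropExtensionality Cantor Eqdep_dec.
Require Import Defs.
Import ListNotations.

(* Let A_1, A_2, ... be the sets coded by x. We enlarge the family of their
   elements, the elements of A_{j+1} becoming "objects of level j", by dummy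
   objects: a dummy of level j is a finite term whose leaves are elements of
   A_1, ..., A_{j+1}. It carries a table prescribing its membership relation to
   finitely many objects of level j-1, and a table prescribing its relation to
   finitely many objects o of level j+1, where o is described by its trace: the
   leaves of o of level j+1 are replaced by their membership pattern on a finite
   set R of elements of A_{j+1}. Traces keep the leaves of a term of level j at
   levels at most j, while a large enough R tells finitely many o's apart. So
   every finite pattern of relations to the adjacent levels is realised by a
   dummy. A term of level 0 has only reals as leaves, hence is coded by a real,
   and a fusion argument sends these codes to mutually generic reals.

   The resulting structure depends only on the A_j, and by realisation of
   patterns it can be enumerated, in a Borel way, so as to meet any given
   sequence of dense open sets; the enumeration is the value of the reduction at
   x. Conversely an object of level j+1 is determined by the objects of level j
   related to it, so the A_j can be read off level by level. *)

Definition decb (P : Prop) : bool :=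
  if excluded_middle_informative P then true else false.

Lemma decb_true (P : Prop) : decb P = true <-> P.
Proof. unfold decb; destruct (excluded_middle_informative P); split; congruence || tauto. Qed.

(** * Terms *)

(** Terms serve at once as objects, keys and tables. A dummy is laid out as
    [Pr R (Pr up (Pr down (At i)))]: the list [R] used for traces, the table towards the level
    above, the table towards the level below, and a number. Missing fields are read as junk, so
    every term is an object and no well-formedness condition arises. *)
Inductive tm (L : Type) : Type :=
  | Lf (a : L)
  | At (k : nat)
  | Pr (t u : tm L).
Arguments Lf {L} a.
Arguments At {L} k.
Arguments Pr {L} t u.

Fixpoint tmap {L L'} (h : L -> L') (t : tm L) : tm L' :=
  match t with
  | Lf a => Lf (h a)
  | At k => At k
  | Pr t u => Pr (tmap h t) (tmap h u)
  end.

Fixpoint allL {L} (P : L -> Prop) (t : tm L) : Prop :=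
  match t with
  | Lf a => P a
  | At _ => True
  | Pr t u => allL P t /\ allL P u
  end.

Fixpoint lvs {L} (t : tm L) : list L :=
  match t with
  | Lf a => [a]
  | At _ => []
  | Pr t u => lvs t ++ lvs u
  end.

Fixpoint sz {L} (t : tm L) : nat :=
  match t with
  | Lf _ => 1
  | At k => S k
  | Pr t u => S (sz t + sz u)
  end.

Definition car {L} (t : tm L) : tm L := match t with Pr a _ => a | _ => t end.
Definition cdr {L} (t : tm L) : tm L := match t with Pr _ b => b | _ => t end.
Definition truth {L} (t : tm L) : bool := match t with At 0 => false | _ => true end.

Fixpoint lookup {L} (k p : tm L) : option bool :=
  match p with
  | Pr e p' =>
      if excluded_middle_informative (k = car e) then Some (truth (cdr e))
      else lookup k p'
  | _ => None
  end.

Lemma allL_impl {L} (P Q : L -> Prop) t :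
  (forall a, P a -> Q a) -> allL P t -> allL Q t.
Proof. intros H; induction t; simpl; intuition. Qed.

Lemma allL_lvs {L} (P : L -> Prop) t : allL P t <-> (forall a, In a (lvs t) -> P a).
Proof.
  induction t as [a|k|t IHt u IHu]; simpl.
  - intuition; now subst.
  - intuition.
  - rewrite IHt, IHu; setoid_rewrite in_app_iff; firstorder.
Qed.

Lemma allL_car {L} (P : L -> Prop) t : allL P t -> allL P (car t).
Proof. destruct t; simpl; tauto. Qed.

Lemma allL_cdr {L} (P : L -> Prop) t : allL P t -> allL P (cdr t).
Proof. destruct t; simpl; tauto. Qed.

Lemma allL_tmap {L L'} (h : L -> L') (P : L' -> Prop) t :
  allL P (tmap h t) <-> allL (fun a => P (h a)) t.
Proof. induction t; simpl; intuition. Qed.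

Lemma tmap_ext {L L'} (h h' : L -> L') t :
  allL (fun a => h a = h' a) t -> tmap h t = tmap h' t.
Proof. induction t; simpl; intros H; f_equal; tauto. Qed.

Lemma tmap_id {L} (t : tm L) : tmap (fun a => a) t = t.
Proof. induction t; simpl; f_equal; auto. Qed.

Lemma tmap_comp {L L' L''} (h : L -> L') (g : L' -> L'') t :
  tmap g (tmap h t) = tmap (fun a => g (h a)) t.
Proof. induction t; simpl; f_equal; auto. Qed.

Lemma tmap_car {L L'} (h : L -> L') t : car (tmap h t) = tmap h (car t).
Proof. now destruct t. Qed.

Lemma tmap_cdr {L L'} (h : L -> L') t : cdr (tmap h t) = tmap h (cdr t).
Proof. now destruct t. Qed.

Lemma tmap_truth {L L'} (h : L -> L') t : truth (tmap h t) = truth t.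
Proof. now destruct t. Qed.

Lemma tmap_inj {L L'} (h : L -> L') (P : L -> Prop) :
  (forall a b, P a -> P b -> h a = h b -> a = b) ->
  forall t u, allL P t -> allL P u -> tmap h t = tmap h u -> t = u.
Proof.
  intros H; induction t; intros []; simpl; intros Ht Hu E; try discriminate;
    injection E; intros; f_equal; try apply H; intuition.
Qed.

Lemma tmap_surj {L L'} (h : L -> L') (P : L -> Prop) (t : tm L') :
  allL (fun b => exists a, P a /\ h a = b) t -> exists u, allL P u /\ tmap h u = t.
Proof.
  induction t as [b|k|t IHt u IHu]; simpl; intros H.
  - destruct H as [a [Ha <-]]; now exists (Lf a).
  - now exists (At k).
  - destruct IHt as [t' [? <-]], IHu as [u' [? <-]]; try tauto; now exists (Pr t' u').
Qed.

Lemma sz_car {L} (t : tm L) : sz (car t) <= sz t.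
Proof. destruct t; simpl; lia. Qed.

Lemma sz_cdr {L} (t : tm L) : sz (cdr t) <= sz t.
Proof. destruct t; simpl; lia. Qed.

(** Size replaces a freshness condition: a table inside a small term cannot contain an entry for a
    large one. *)
Lemma lookup_sz {L} (k p : tm L) b : lookup k p = Some b -> sz k <= sz p.
Proof.
  induction p as [a|m|e _ p IH]; simpl; try discriminate.
  destruct excluded_middle_informative as [->|_].
  - intros _; pose proof (sz_car e); lia.
  - intros H; specialize (IH H); lia.
Qed.

Lemma lookup_tmap {L L'} (h : L -> L') (P : L -> Prop) :
  (forall a b, P a -> P b -> h a = h b -> a = b) ->
  forall k p, allL P k -> allL P p -> lookup (tmap h k) (tmap h p) = lookup k p.
Proof.
  intros H k; induction p as [a|m|e _ p IH]; simpl; auto; intros Hk [He Hp].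
  rewrite tmap_car, tmap_cdr, tmap_truth, (IH Hk Hp).
  destruct (excluded_middle_informative (k = car e)) as [->|N].
  - destruct excluded_middle_informative; congruence.
  - destruct excluded_middle_informative as [E|_]; auto.
    exfalso; apply N; revert E; apply (tmap_inj h P); auto using allL_car.
Qed.

Fixpoint tab {L A} (g : A -> tm L) (e : A -> bool) (l : list A) : tm L :=
  match l with
  | [] => At 0
  | s :: l => Pr (Pr (g s) (At (Nat.b2n (e s)))) (tab g e l)
  end.

Lemma allL_tab {L A} (P : L -> Prop) (g : A -> tm L) e l :
  (forall s, In s l -> allL P (g s)) -> allL P (tab g e l).
Proof. induction l; simpl; auto. Qed.

Lemma lookup_tab {L A} (g : A -> tm L) e l s :
  (forall s', In s' l -> g s = g s' -> s = s') -> In s l ->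
  lookup (g s) (tab g e l) = Some (e s).
Proof.
  induction l as [|s' l IH]; simpl; [tauto|]; intros Hg Hs.
  destruct excluded_middle_informative as [E|N].
  - rewrite <- (Hg s' (or_introl eq_refl) E); now destruct (e s).
  - destruct Hs as [->|Hs]; [congruence|]; auto.
Qed.

(* In [bit], [d] has level [j] and [o] level [S j]. In [trace], leaves of level
   above [j] become their membership pattern on [R], and the shift of the atoms
   keeps this replacement unambiguous. *)
Fixpoint pat {L} (mem : L -> L -> bool) (a : L) (R : tm L) : tm L :=
  match R with
  | Lf r => At (Nat.b2n (mem a r))
  | At k => At k
  | Pr t u => Pr (pat mem a t) (pat mem a u)
  end.

Fixpoint trace {L} (lev : L -> nat) (mem : L -> L -> bool) (j : nat) (R t : tm L) : tm L :=
  match t with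
  | Lf a => if j <? lev a then Pr (At 0) (pat mem a R) else Lf a
  | At k => At (S k)
  | Pr t u => Pr (trace lev mem j R t) (trace lev mem j R u)
  end.

Definition leafmem {L} (mem : L -> L -> bool) (o d : tm L) : bool :=
  match o, d with Lf a, Lf r => mem a r | _, _ => false end.

Definition bit {L} (lev : L -> nat) (mem : L -> L -> bool) (j : nat) (o d : tm L) : bool :=
  match lookup (trace lev mem j (car d) o) (car (cdr d)) with
  | Some b => b
  | None =>
      match lookup d (car (cdr (cdr o))) with
      | Some b => b
      | None => leafmem mem o d
      end
  end.

Lemma allL_pat {L} mem (P : L -> Prop) a R : allL P (pat mem a R).
Proof. induction R; simpl; auto. Qed.

Lemma sz_trace {L} lev mem j (R t : tm L) : sz t <= sz (trace lev mem j R t).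
Proof. induction t; simpl; try lia. destruct (j <? lev a); simpl; lia. Qed.

Lemma allL_trace {L} lev mem j (R t : tm L) (P : L -> Prop) :
  allL P t -> allL (fun a => P a /\ lev a <= j) (trace lev mem j R t).
Proof.
  induction t; simpl; try tauto; intros H.
  destruct (Nat.ltb_spec j (lev a)); simpl; auto using allL_pat.
Qed.

Lemma trace_neq_At0 {L} lev mem j (R t : tm L) : trace lev mem j R t <> At 0.
Proof. destruct t; simpl; try discriminate. destruct (j <? lev a); discriminate. Qed.

(** The shift keeps [At 0] out of the range of [trace], so a pair headed by [At 0] can only come
    from a replaced leaf. Hence the trace loses nothing but the identity of leaves with the same
    pattern on [R]. *)
Lemma trace_inj {L} (lev : L -> nat) mem j R : forall s s',
  (forall a a', In a (lvs s) -> In a' (lvs s') -> j < lev a -> j < lev a' ->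
     pat mem a R = pat mem a' R -> a = a') ->
  trace lev mem j R s = trace lev mem j R s' -> s = s'.
Proof.
  induction s as [a|k|t IHt u IHu]; intros [a'|k'|t' u'] H; simpl in *; intros E;
    repeat match goal with
    | E : context [j <? lev ?b] |- _ => destruct (Nat.ltb_spec j (lev b))
    end; try discriminate; injection E; intros; subst; auto.
  - f_equal; apply H; auto.
  - exfalso; symmetry in H2; now apply trace_neq_At0 in H2.
  - exfalso; now apply trace_neq_At0 in H2.
  - f_equal; [apply IHt|apply IHu]; auto; intros; apply H; auto using in_or_app.
Qed.

Lemma pat_tmap {L L'} (h : L -> L') mem mem' (P : L -> Prop) :
  (forall a b, P a -> P b -> mem' (h a) (h b) = mem a b) ->
  forall a R, P a -> allL P R -> pat mem' (h a) (tmap h R) = tmap h (pat mem a R).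
Proof. intros H a R Ha; induction R; simpl; intros; f_equal; intuition. now rewrite H. Qed.

Lemma trace_tmap {L L'} (h : L -> L') lev lev' mem mem' (P : L -> Prop) :
  (forall a, P a -> lev' (h a) = lev a) ->
  (forall a b, P a -> P b -> mem' (h a) (h b) = mem a b) ->
  forall j R t, allL P R -> allL P t ->
  trace lev' mem' j (tmap h R) (tmap h t) = tmap h (trace lev mem j R t).
Proof.
  intros Hl Hm j R t HR; induction t; simpl; intros; f_equal; intuition.
  rewrite Hl by auto; destruct (j <? lev a); simpl; auto; f_equal.
  now apply (pat_tmap h mem mem' P).
Qed.

(** Serves twice: to pass from indices to the sets they denote, and, with [h] the identity, to
    compare two membership relations that agree on the leaves involved. *)
Lemma bit_tmap {L L'} (h : L -> L') lev lev' mem mem' (P : L -> Prop) :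
  (forall a b, P a -> P b -> h a = h b -> a = b) ->
  (forall a, P a -> lev' (h a) = lev a) ->
  (forall a b, P a -> P b -> mem' (h a) (h b) = mem a b) ->
  forall j o d, allL P o -> allL P d ->
  bit lev' mem' j (tmap h o) (tmap h d) = bit lev mem j o d.
Proof.
  intros Hi Hl Hm j o d Ho Hd; unfold bit.
  rewrite !tmap_cdr, !tmap_car, (trace_tmap h lev lev' mem mem' P);
    auto using allL_car.
  rewrite !(lookup_tmap h P); auto using allL_car, allL_cdr.
  - destruct (lookup _ (car (cdr d))); auto; destruct (lookup d _); auto.
    destruct o, d; simpl in *; auto.
  - eapply allL_impl; [|apply allL_trace, Ho]; intros ? []; auto.
Qed.

(** [R] collects one separating element for each pair of distinct entries. *)
Lemma distinguish {L} (lev : L -> nat) mem j (P : L -> Prop) (l : list (L * L)) :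
  (forall a a', In (a, a') l -> a <> a' ->
     exists r, P r /\ lev r = j /\ mem a r <> mem a' r) ->
  exists R, allL (fun r => P r /\ lev r <= j) R /\
    forall a a', In (a, a') l -> pat mem a R = pat mem a' R -> a = a'.
Proof.
  induction l as [|[b b'] l IH]; intros H.
  - exists (At 0); split; [exact I|]; intros ? ? [].
  - destruct IH as [R [HR1 HR2]]; [intros; apply H; simpl; auto|].
    destruct (classic (b = b')) as [->|N].
    + exists R; split; auto; intros a a' [E|Hin]; auto; congruence.
    + destruct (H b b') as [r [Hr1 [Hr2 Hr3]]]; simpl; auto.
      exists (Pr (Lf r) R); split; [simpl; repeat split; auto; lia|].
      intros a a' [E|Hin] Ep; injection Ep; intros Ep1 Ep2; auto.
      injection E; intros; subst; exfalso; apply Hr3.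
      now destruct (mem a r), (mem a' r).
Qed.

(** * The extension property *)

(** The new term [d] carries both tables explicitly. Entries for [ss] are keyed by traces, which [R]
    keeps distinct. Against [ts], the upward table of [t] would be consulted first, but [d] is too
    large to occur in it, so the downward table of [d] decides. *)
Lemma extension {L} (lev : L -> nat) mem j (P : L -> Prop) (ss ts : list (tm L))
    (e e' : tm L -> bool) (B i : nat) :
  (forall a a', P a -> P a' -> lev a = S j -> lev a' = S j -> a <> a' ->
     exists r, P r /\ lev r = j /\ mem a r <> mem a' r) ->
  (forall s, In s ss -> allL (fun a => P a /\ lev a <= S j) s) ->
  (forall t, In t ts -> allL (fun a => P a /\ lev a <= j) t) ->
  (forall t, In t ts -> sz t <= i) -> B <= i ->
  exists d, allL (fun a => P a /\ lev a <= j) d /\ B < sz d /\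
    cdr (cdr (cdr d)) = At i /\
    (forall s, In s ss -> bit lev mem j s d = e s) /\
    (forall t j', In t ts -> bit lev mem j' d t = e' t).
Proof.
  intros Hd Hs Ht Hi HB.
  (* Only leaves above level [j] are altered by [trace]; in [ss] these have level exactly [S j], so
     the separation hypothesis applies to them. *)
  set (lv := filter (fun a => j <? lev a) (flat_map lvs ss)).
  assert (Hlv : forall a, In a lv -> P a /\ lev a = S j).
  { intros a Ha; apply filter_In in Ha as [Ha1 Ha2].
    apply in_flat_map in Ha1 as [s [Hs1 Hs2]].
    apply Nat.ltb_lt in Ha2; specialize (Hs s Hs1); rewrite allL_lvs in Hs.
    destruct (Hs a Hs2); split; auto; lia. }
  destruct (distinguish lev mem j P (list_prod lv lv)) as [R [HR1 HR2]].
  { intros a a' Ha N; apply in_prod_iff in Ha as [Ha Ha'].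
    apply Hlv in Ha as []; apply Hlv in Ha' as []; auto. }
  exists (Pr R (Pr (tab (trace lev mem j R) e ss) (Pr (tab (fun t => t) e' ts) (At i)))).
  split; [|split; [|split; [|split]]].
  - simpl; repeat split; auto.
    + apply allL_tab; intros s Hs'.
      apply (allL_impl (fun a => (P a /\ lev a <= S j) /\ lev a <= j)); [tauto|].
      apply allL_trace; auto.
    + apply allL_tab; auto.
  - simpl; lia.
  - reflexivity.
  - intros s Hin; unfold bit; cbn [car cdr].
    rewrite (lookup_tab (trace lev mem j R)); auto.
    intros s' Hin' E; apply trace_inj in E; auto.
    intros a a' Ha Ha' La La' Ep; apply HR2; auto.
    apply in_prod; apply filter_In; (split; [|now apply Nat.ltb_lt]);
      apply in_flat_map; eauto.
  - intros t j' Hin; unfold bit; cbn [car cdr].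
    set (d := Pr R _).
    destruct (lookup (trace lev mem j' (car t) d) (car (cdr t))) eqn:E.
    (* The trace of [d] is at least as large as [d], hence larger than [At i] and than [t]. *)
    + exfalso; apply lookup_sz in E.
      pose proof (sz_trace lev mem j' (car t) d); pose proof (sz_car (cdr t));
        pose proof (sz_cdr t); specialize (Hi t Hin); unfold d in *; simpl in *; lia.
    + now rewrite (lookup_tab (fun t => t)).
Qed.

(** * Codings by natural numbers *)

Definition inj {A B} (e : A -> B) : Prop := forall a b, e a = e b -> a = b.

Fixpoint encl {A} (e : A -> nat) (l : list A) : nat :=
  match l with
  | [] => 0
  | a :: l => S (Cantor.to_nat (e a, encl e l))
  end.

Fixpoint enct {A} (e : A -> nat) (t : tm A) : nat :=
  match t with
  | Lf a => Cantor.to_nat (0, e a)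
  | At k => Cantor.to_nat (1, k)
  | Pr t u => Cantor.to_nat (2, Cantor.to_nat (enct e t, enct e u))
  end.

Definition encp {A B} (e : A -> nat) (e' : B -> nat) (p : A * B) : nat :=
  Cantor.to_nat (e (fst p), e' (snd p)).

Lemma to_nat_eq a b a' b' :
  Cantor.to_nat (a, b) = Cantor.to_nat (a', b') -> a = a' /\ b = b'.
Proof. intros E; apply Cantor.to_nat_inj in E; split; congruence. Qed.

Lemma encl_inj {A} (e : A -> nat) : inj e -> inj (encl e).
Proof.
  intros H l; induction l as [|a l IH]; intros [|a' l'] E; cbn [encl] in E; try discriminate; auto.
  injection E as E; apply to_nat_eq in E as []; f_equal; auto.
Qed.

Lemma enct_inj {A} (e : A -> nat) : inj e -> inj (enct e).
Proof.
  intros H t; induction t as [a|k|t IHt u IHu]; intros [a'|k'|t' u'] E; cbn [enct] in E;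
    apply to_nat_eq in E as [? E]; try discriminate.
  - f_equal; auto.
  - f_equal; auto.
  - apply to_nat_eq in E as []; f_equal; auto.
Qed.

Lemma encp_inj {A B} (e : A -> nat) (e' : B -> nat) : inj e -> inj e' -> inj (encp e e').
Proof.
  intros H H' [a b] [a' b'] E; unfold encp in E; simpl in E.
  apply to_nat_eq in E as []; f_equal; auto.
Qed.

Lemma id_inj : inj (fun n : nat => n).
Proof. now intros a b. Qed.

Lemma b2n_inj : inj Nat.b2n.
Proof. now intros [] []. Qed.

Definition decode {A} (e : A -> nat) (a0 : A) (k : nat) : A :=
  epsilon (inhabits a0) (fun a => e a = k).

Lemma decode_enc {A} (e : A -> nat) a0 a : inj e -> decode e a0 (e a) = a.
Proof.
  intros H; apply H; unfold decode.
  apply (epsilon_spec (inhabits a0) (fun b => e b = e a)); eauto.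
Qed.

Lemma bound_list {A} (P : A -> nat -> Prop) (l : list A) :
  (forall a N N', N <= N' -> P a N -> P a N') ->
  (forall a, In a l -> exists N, P a N) -> exists N, forall a, In a l -> P a N.
Proof.
  intros Hm; induction l as [|a l IH]; intros H.
  - exists 0; intros ? [].
  - destruct IH as [N HN]; [intros; apply H; simpl; auto|].
    destruct (H a (or_introl eq_refl)) as [N' HN'].
    exists (max N N'); intros b [<-|Hb]; [apply (Hm _ N')|apply (Hm _ N)]; auto; lia.
Qed.

(** * A perfect family of mutually generic reals *)

Definition agree (s : nat) (c c' : nat -> bool) : Prop := forall m, m < s -> c m = c' m.

Lemma agree_sym s c c' : agree s c c' -> agree s c' c.
Proof. intros H m Hm; symmetry; auto. Qed.

Lemma agree_trans s c c' c'' : agree s c c' -> agree s c' c'' -> agree s c c''.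
Proof. intros H H' m Hm; rewrite H; auto. Qed.

Lemma agree_le s s' c c' : s <= s' -> agree s' c c' -> agree s c c'.
Proof. intros H H' m Hm; apply H'; lia. Qed.

(** [V] is an open dense condition on the first [t] entries alone; the remaining entries do not
    matter. *)
Definition od (t : nat) (V : (nat -> nat -> bool) -> Prop) : Prop :=
  (forall z, V z -> exists N, forall z', (forall k, k < t -> agree N (z' k) (z k)) -> V z') /\
  (forall z M, exists z', (forall k, k < t -> agree M (z' k) (z k)) /\ V z').

Definition dep (s : nat) (g : (nat -> bool) -> nat -> bool) : Prop :=
  forall c c', agree s c c' -> g c = g c'.

(** A fusion condition is a pair [(g, l)]: each node of length [s] is assigned the first [l] bits of
    [g]. Branches not yet separated at height [s] impose nothing. *)
Definition forces (t : nat) (V : (nat -> nat -> bool) -> Prop) (s : nat)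
    (g : (nat -> bool) -> nat -> bool) (l : nat) (c : nat -> nat -> bool) : Prop :=
  (forall k k', k < t -> k' < t -> agree s (c k) (c k') -> k = k') ->
  forall z, (forall k, k < t -> agree l (g (c k)) (z k)) -> V z.

(** Density gives a tuple in [V] extending the current values along the branches [c k]; [g] is
    redefined on the nodes met by these branches and kept elsewhere. *)
Lemma forces_one t V s g l c : od t V -> dep s g ->
  exists g' l', l <= l' /\ dep s g' /\ (forall b, agree l (g b) (g' b)) /\
    forces t V s g' l' c.
Proof.
  intros [Ho Hd] Hg.
  destruct (Hd (fun k => g (c k)) l) as [z [Hz1 Hz2]].
  destruct (Ho z Hz2) as [N HN].
  (* [Q b k] says that [b] passes through the node of [c k]. It depends only on the first [s] bits
     of [b], so [g'] does too; when the nodes are distinct, [k] is unique. *)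
  set (Q b k := k < t /\ agree s (c k) b).
  set (g' b := if excluded_middle_informative (exists k, Q b k)
               then z (epsilon (inhabits 0) (Q b)) else g b).
  exists g', (max l N); split; [lia|split; [|split]].
  - intros b b' Hb.
    assert (HQ : Q b = Q b').
    { apply functional_extensionality; intros k; apply propositional_extensionality.
      unfold Q; split; intros [H1 H2]; split; auto;
        [apply (agree_trans _ _ b)|apply (agree_trans _ _ b')]; auto using agree_sym. }
    unfold g'; rewrite HQ; now rewrite (Hg b b' Hb).
  - intros b; unfold g'; destruct excluded_middle_informative as [H|H]; [|now intros m].
    destruct (epsilon_spec (inhabits 0) (Q b) H) as [H1 H2].
    rewrite <- (Hg _ _ H2); auto using agree_sym.
  - intros Hc z' Hz'; apply HN; intros k Hk; apply agree_sym.
    assert (E : g' (c k) = z k).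
    { unfold g'; destruct excluded_middle_informative as [H|H].
      - destruct (epsilon_spec (inhabits 0) (Q (c k)) H) as [H1 H2]; f_equal; auto.
      - exfalso; apply H; exists k; split; auto; now intros m. }
    rewrite <- E; eapply agree_le; [|apply Hz'; auto]; lia.
Qed.

(** What is forced stays forced, because later functions agree with earlier ones up to the length
    already fixed. *)
Lemma forces_list (t : nat -> nat) (V : nat -> (nat -> nat -> bool) -> Prop) s
    (tasks : list (nat * (nat -> nat -> bool))) : (forall q, od (t q) (V q)) -> forall g l, dep s g ->
  exists g' l', l <= l' /\ dep s g' /\ (forall b, agree l (g b) (g' b)) /\
    forall q c, In (q, c) tasks -> forces (t q) (V q) s g' l' c.
Proof.
  intros HV; induction tasks as [|[q0 c0] tasks IH]; intros g l Hg.
  - exists g, l; repeat split; auto; intros ? ? [].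
  - destruct (forces_one _ _ s g l c0 (HV q0) Hg) as [g1 [l1 [Hl1 [Hg1 [Ha1 Hf1]]]]].
    destruct (IH g1 l1 Hg1) as [g2 [l2 [Hl2 [Hg2 [Ha2 Hf2]]]]].
    exists g2, l2; split; [lia|split; [auto|split]].
    + intros b; apply (agree_trans _ _ (g1 b)); auto; now apply (agree_le l l1).
    + intros q c [E|Hin]; auto; injection E; intros; subst.
      intros Hc z Hz; apply Hf1; auto; intros k Hk.
      apply (agree_trans _ _ (g2 (c k))); auto; now apply (agree_le l1 l2); auto.
Qed.

Fixpoint allseq {A} (l : list A) (t : nat) : list (list A) :=
  match t with
  | 0 => [[]]
  | S t => flat_map (fun a => map (cons a) (allseq l t)) l
  end.

Lemma in_allseq {A} (l s : list A) : (forall a, In a s -> In a l) -> In s (allseq l (length s)).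
Proof.
  induction s as [|a s IH]; simpl; auto; intros H.
  apply in_flat_map; exists a; split; auto; apply in_map; auto.
Qed.

Definition prefix (s : nat) (c : nat -> bool) : list bool := map c (seq 0 s).

Lemma nth_prefix s c m : m < s -> nth m (prefix s c) false = c m.
Proof.
  intros H; unfold prefix.
  rewrite (nth_indep _ false (c 0)) by now rewrite length_map, length_seq.
  now rewrite map_nth, seq_nth.
Qed.

Definition of_strings (tp : list (list bool)) : nat -> nat -> bool :=
  fun k m => nth m (nth k tp []) false.

Definition strings (s : nat) : list (list bool) := allseq [true; false] s.

Lemma in_strings s c : In (prefix s c) (strings s).
Proof.
  unfold strings; replace s with (length (prefix s c)) at 2.
  - apply in_allseq; intros [] _; simpl; auto.
  - unfold prefix; now rewrite length_map, length_seq.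
Qed.

Definition refines (t : nat -> nat) (V : nat -> (nat -> nat -> bool) -> Prop) (s : nat)
    (p p' : ((nat -> bool) -> nat -> bool) * nat) : Prop :=
  snd p < snd p' /\ dep (S s) (fst p') /\ (forall b, agree (snd p) (fst p b) (fst p' b)) /\
  forall q c, q <= s -> forces (t q) (V q) s (fst p') (snd p') c.

(** [forces] sees a tuple only through its restrictions to length [s], so stage [s] has finitely
    many tasks: the requirements up to [s] at all tuples of strings of length [s]. *)
Lemma refines_ex t V s p : (forall q, od (t q) (V q)) -> dep s (fst p) ->
  exists p', refines t V s p p'.
Proof.
  intros HV Hp; destruct p as [g l]; simpl in Hp.
  (* Starting from length [S l] makes the length grow strictly. *)
  destruct (forces_list t V s
    (flat_map (fun q => map (fun tp => (q, of_strings tp)) (allseq (strings s) (t q)))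
      (seq 0 (S s))) HV g (S l) Hp) as [g' [l' [Hl [Hg' [Ha Hf]]]]].
  exists (g', l'); repeat split; simpl; auto.
  - intros c c' Hc; apply Hg', (agree_le s (S s)); auto.
  - intros b; apply (agree_le l (S l)); auto.
  - intros q c Hq Hc z Hz.
    set (tp := map (fun k => prefix s (c k)) (seq 0 (t q))).
    assert (Htp : forall k, k < t q -> agree s (of_strings tp k) (c k)).
    { intros k Hk m Hm; unfold of_strings, tp.
      rewrite (nth_indep _ [] (prefix s (c 0))) by now rewrite length_map, length_seq.
      rewrite (map_nth (fun k => prefix s (c k))), seq_nth by auto; simpl.
      now apply nth_prefix. }
    apply (Hf q (of_strings tp)).
    + apply in_flat_map; exists q; split; [apply in_seq; lia|].
      apply in_map_iff; exists tp; split; auto.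
      replace (t q) with (length tp) by (unfold tp; now rewrite length_map, length_seq).
      apply in_allseq; intros a Ha'; unfold tp in Ha'; apply in_map_iff in Ha' as [k [<- _]].
      apply in_strings.
    + intros k k' Hk Hk' E; apply Hc; auto.
      apply (agree_trans _ _ (of_strings tp k)); [apply agree_sym; auto|].
      apply (agree_trans _ _ (of_strings tp k')); auto.
    + intros k Hk; rewrite (Hg' _ _ (Htp k Hk)); auto.
Qed.

Theorem generic_family (t : nat -> nat) (V : nat -> (nat -> nat -> bool) -> Prop) :
  (forall q, od (t q) (V q)) ->
  exists G : (nat -> bool) -> nat -> bool,
    (forall m c c', agree (S m) c c' -> G c m = G c' m) /\
    forall q c, (forall k k', k < t q -> k' < t q -> c k = c k' -> k = k') ->
      V q (fun k => G (c k)).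
Proof.
  intros HV.
  set (p0 := ((fun _ _ => false) : (nat -> bool) -> nat -> bool, 0)).
  set (p := fix p s := match s with
    0 => p0 | S s => epsilon (inhabits p0) (refines t V s (p s)) end).
  assert (Hp : forall s, dep s (fst (p s)) /\ refines t V s (p s) (p (S s))).
  { assert (Hr : forall s, dep s (fst (p s)) -> refines t V s (p s) (p (S s))).
    { intros s Hs; simpl; apply epsilon_spec; now apply refines_ex. }
    intros s; split; auto; [|apply Hr]; induction s; try now intros c c'.
    - destruct (Hr s IHs); tauto.
    - destruct (Hr s IHs); tauto. }
  assert (Hlen : forall s, s <= snd (p s)).
  { induction s; [lia|]; destruct (Hp s) as [_ [H _]]; lia. }
  assert (Hcoh : forall d s b, agree (snd (p s)) (fst (p s) b) (fst (p (d + s)) b) /\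
      snd (p s) <= snd (p (d + s))).
  { induction d as [|d IH]; intros s b; [split; [now intros m|auto]|].
    destruct (IH s b) as [H1 H2]; change (S d + s) with (S (d + s)).
    destruct (Hp (d + s)) as [_ [H3 [_ [H4 _]]]]; split; [|lia].
    apply (agree_trans _ _ (fst (p (d + s)) b)); auto.
    apply (agree_le _ (snd (p (d + s)))); auto. }
  (* Bit [m] is settled at stage [S m], whose length is at least [S m]; it depends only on the first
     [S m] bits of [c]. *)
  exists (fun c m => fst (p (S m)) c m); split.
  - intros m c c' H; destruct (Hp (S m)) as [H1 _]; now rewrite (H1 c c' H).
  - assert (HG : forall s c, agree (snd (p s)) (fst (p s) c) (fun m => fst (p (S m)) c m)).
    { intros s c m Hm; destruct (Nat.le_gt_cases s (S m)) as [Hs|Hs].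
      - destruct (Hcoh (S m - s) s c) as [H _]; replace (S m - s + s) with (S m) in H by lia.
        now apply H.
      - destruct (Hcoh (s - S m) (S m) c) as [H _]; replace (s - S m + S m) with s in H by lia.
        symmetry; apply H; apply (Nat.lt_le_trans _ (S m)); auto. }
    intros q c Hc.
    destruct (bound_list (fun kk s => agree s (c (fst kk)) (c (snd kk)) -> fst kk = snd kk)
      (list_prod (seq 0 (t q)) (seq 0 (t q)))) as [N HN].
    + intros [k k'] N N' H H' H''; apply H'; now apply (agree_le N N').
    + intros [k k'] Hin; apply in_prod_iff in Hin as [Hk Hk']; simpl.
      apply in_seq in Hk; apply in_seq in Hk'.
      destruct (classic (c k = c k')) as [E|E]; [exists 0; intros _; apply Hc; auto; lia|].
      apply NNPP; intros H; apply E, functional_extensionality; intros m; apply NNPP; intros Hm.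
      apply H; exists (S m); intros Ha; exfalso; apply Hm, Ha; auto.
    (* By stage [N] the branches are separated, and from stage [q] on requirement [q] is treated. *)
    + destruct (Hp (max N q)) as [_ [_ [_ [_ Hf]]]].
      apply (Hf q c); [lia| |].
      * intros k k' Hk Hk' Ha; apply (HN (k, k')).
        -- apply in_prod; apply in_seq; lia.
        -- apply (agree_le N (max N q)); auto; lia.
      * intros k Hk; apply HG.
Qed.

Definition ow (u : list bool) (z : nat -> bool) (m : nat) : bool :=
  if m <? length u then nth m u false else z m.

Lemma ow_agree u z z' s : agree s z z' -> agree s (ow u z) (ow u z').
Proof. intros H m Hm; unfold ow; destruct (m <? length u); auto. Qed.

(** Prescribing initial segments preserves open density, so the family can be made generic for all
    of its finite modifications as well. *)
Lemma od_ow t V (u : nat -> list bool) : od t V -> od t (fun z => V (fun k => ow (u k) (z k))).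
Proof.
  intros [Ho Hd]; split.
  - intros z Hz; destruct (Ho _ Hz) as [N HN]; exists N; intros z' Hz'.
    apply HN; intros k Hk; apply ow_agree; auto.
  - intros z M.
    destruct (bound_list (fun k N => length (u k) <= N) (seq 0 t)) as [B HB];
      [intros; lia|eauto|].
    destruct (Hd (fun k => ow (u k) (z k)) (max M B)) as [z' [Hz1 Hz2]].
    (* The tuple [z'] found in [V] already begins with the segments [u k]; below them the original
       bits are restored, and overwriting brings [z'] back. *)
    exists (fun k m => if m <? length (u k) then z k m else z' k m); split.
    + intros k Hk m Hm; destruct (Nat.ltb_spec m (length (u k))); auto.
      rewrite Hz1 by (auto; lia); unfold ow.
      now destruct (Nat.ltb_spec m (length (u k))); [lia|].
    + destruct (Ho _ Hz2) as [N HN]; apply HN; intros k Hk m Hm; unfold ow.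
      destruct (Nat.ltb_spec m (length (u k))) as [H|H]; auto.
      assert (length (u k) <= B) by (apply HB, in_seq; lia).
      rewrite Hz1 by (auto; lia); unfold ow; destruct (Nat.ltb_spec m (length (u k))); auto; lia.
Qed.

(** * Borel sets and maps *)

Lemma borel_ext (P Q : Pt -> Prop) : (forall x, P x <-> Q x) -> borel P -> borel Q.
Proof.
  intros H HP; replace Q with P; auto.
  apply functional_extensionality; intros x; now apply propositional_extensionality.
Qed.

Lemma borel_const (P : Prop) : borel (fun _ => P).
Proof. apply borel_open; intros x H; now exists 0. Qed.

Lemma borel_exists {A} (e : A -> nat) (a0 : A) (P : A -> Pt -> Prop) :
  inj e -> (forall a, borel (P a)) -> borel (fun x => exists a, P a x).
Proof.
  intros He HP; apply (borel_ext (fun x => exists k, P (decode e a0 k) x)).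
  - intros x; split; intros [a Ha]; eauto.
    exists (e a); now rewrite decode_enc.
  - now apply borel_union.
Qed.

Lemma borel_forall {A} (e : A -> nat) (a0 : A) (P : A -> Pt -> Prop) :
  inj e -> (forall a, borel (P a)) -> borel (fun x => forall a, P a x).
Proof.
  intros He HP; apply (borel_ext (fun x => ~ exists a, ~ P a x)).
  - intros x; split; [|firstorder]; intros H a; apply NNPP; eauto.
  - apply borel_compl, (borel_exists e a0); auto; intros; now apply borel_compl.
Qed.

Lemma borel_or (P Q : Pt -> Prop) : borel P -> borel Q -> borel (fun x => P x \/ Q x).
Proof.
  intros HP HQ.
  apply (borel_ext (fun x => exists b : bool, (if b then P else Q) x)).
  - intros x; split; [intros [[] H]; auto|].
    intros [H|H]; [now exists true|now exists false].
  - apply (borel_exists Nat.b2n true); [apply b2n_inj|]; now intros [].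
Qed.

Lemma borel_and (P Q : Pt -> Prop) : borel P -> borel Q -> borel (fun x => P x /\ Q x).
Proof.
  intros HP HQ; apply (borel_ext (fun x => ~ (~ P x \/ ~ Q x))); [intros; tauto|].
  apply borel_compl, borel_or; now apply borel_compl.
Qed.

Lemma borel_imp (P Q : Pt -> Prop) : borel P -> borel Q -> borel (fun x => P x -> Q x).
Proof.
  intros HP HQ; apply (borel_ext (fun x => ~ P x \/ Q x)); [intros; tauto|].
  apply borel_or; auto; now apply borel_compl.
Qed.

Definition near (N : nat) (y x : Pt) : Prop :=
  forall i k m, i < N -> k < N -> m < N -> y i k m = x i k m.

Lemma near_le N N' y x : N <= N' -> near N' y x -> near N y x.
Proof. intros H H' i k m; intros; apply H'; lia. Qed.

Definition local {A} (h : Pt -> A) : Prop :=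
  exists N, forall x y, near N y x -> h y = h x.

Lemma borel_local (h : Pt -> bool) : local h -> borel (fun x => h x = true).
Proof.
  intros [N HN]; apply borel_open; intros x Hx; exists N; intros y Hy.
  now rewrite (HN x y Hy).
Qed.

Lemma borel_coord i k m : borel (fun x => x i k m = true).
Proof. apply borel_local; exists (S (i + k + m)); intros x y H; apply H; lia. Qed.

Definition trip : Type := nat * (nat * nat).
Definition enc_trip : trip -> nat := encp (fun n => n) (encp (fun n => n) (fun n => n)).

Lemma enc_trip_inj : inj enc_trip.
Proof. repeat apply encp_inj; apply id_inj. Qed.

Definition cube (N : nat) : list trip := list_prod (seq 0 N) (list_prod (seq 0 N) (seq 0 N)).

Lemma in_cube N i k m : In (i, (k, m)) (cube N) <-> i < N /\ k < N /\ m < N.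
Proof. unfold cube; rewrite !in_prod_iff, !in_seq; lia. Qed.

Definition pattern (N : nat) (y : Pt) : list trip :=
  filter (fun p => y (fst p) (fst (snd p)) (snd (snd p))) (cube N).

Definition of_pattern (l : list trip) : Pt := fun i k m => decb (In (i, (k, m)) l).

Lemma near_pattern N y : near N (of_pattern (pattern N y)) y.
Proof.
  intros i k m Hi Hk Hm; unfold of_pattern, pattern; apply eq_true_iff_eq.
  rewrite decb_true, filter_In, in_cube; simpl; tauto.
Qed.

(** An open set is a countable union of sets given by finite patterns, so Borel coordinates
    suffice. *)
Lemma borel_preimage (f : Pt -> Pt) :
  (forall i k m, borel (fun x => f x i k m = true)) ->
  forall B, borel B -> borel (fun x => B (f x)).
Proof.
  intros Hf B HB; induction HB as [U HU|B HB IH|Bs HB IH].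
  - apply (borel_ext (fun x => exists l : list trip, exists N,
      (forall y, near N y (of_pattern l) -> U y) /\
      forall i k m, (i < N /\ k < N /\ m < N) ->
        (f x i k m = true <-> of_pattern l i k m = true))).
    + intros x; split.
      * intros [l [N [H1 H2]]]; apply H1; intros i k m Hi Hk Hm.
        apply eq_true_iff_eq; apply H2; auto.
      * intros H; destruct (HU _ H) as [N HN]; exists (pattern N (f x)), N; split.
        -- intros y Hy; apply HN; intros i k m Hi Hk Hm.
           now rewrite Hy, near_pattern.
        -- intros i k m [Hi [Hk Hm]]; now rewrite near_pattern.
    + apply (borel_exists (encl enc_trip) []); [apply encl_inj, enc_trip_inj|]; intros l.
      apply (borel_exists (fun n => n) 0); [apply id_inj|]; intros N.
      apply borel_and; [apply borel_const|].
      do 3 (apply (borel_forall (fun n => n) 0); [apply id_inj|]; intros ?).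
      apply borel_imp; [apply borel_const|].
      apply borel_and; apply borel_imp; auto using borel_const.
  - now apply (borel_compl (fun x => B (f x))).
  - now apply (borel_union (fun k x => Bs k (f x))).
Qed.

(** * Borel choice of a least witness *)

Definition least {A} (e : A -> nat) (P : A -> Prop) (a : A) : Prop :=
  P a /\ forall b, P b -> e a <= e b.

Definition pick {A} (e : A -> nat) (a0 : A) (P : A -> Prop) : A :=
  if excluded_middle_informative (exists a, P a)
  then epsilon (inhabits a0) (least e P) else a0.

Lemma pick_least {A} (e : A -> nat) a0 (P : A -> Prop) :
  (exists a, P a) -> least e P (pick e a0 P).
Proof.
  intros H; unfold pick; destruct excluded_middle_informative as [_|]; [|tauto].
  apply epsilon_spec; destruct H as [a Ha].
  revert a Ha; assert (H : forall n a, e a <= n -> P a -> exists a, least e P a).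
  { induction n as [|n IH]; intros a Hn Ha.
    - exists a; split; auto; intros; lia.
    - destruct (classic (exists b, P b /\ e b <= n)) as [[b [Hb1 Hb2]]|N]; [eauto|].
      exists a; split; auto; intros b Hb.
      destruct (Nat.le_gt_cases (e b) n); [exfalso; eauto|lia]. }
  eauto.
Qed.

Lemma borel_pick {A} (e : A -> nat) a0 (P : Pt -> A -> Prop) a : inj e ->
  (forall a, borel (fun x => P x a)) -> borel (fun x => pick e a0 (P x) = a).
Proof.
  intros He HP.
  apply (borel_ext (fun x => least e (P x) a \/ (~ (exists b, P x b)) /\ a = a0)).
  - intros x; split.
    + intros [H|[H ->]].
      * destruct (pick_least e a0 (P x)) as [H1 H2]; [destruct H; eauto|].
        destruct H as [H3 H4]; apply He; apply Nat.le_antisymm; auto.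
      * unfold pick; destruct excluded_middle_informative; tauto.
    + intros <-; destruct (classic (exists b, P x b)) as [H|H].
      * left; now apply pick_least.
      * right; split; auto; unfold pick; destruct excluded_middle_informative; tauto.
  - apply borel_or; [unfold least; apply borel_and; auto|].
    + apply (borel_forall e a0); auto; intros b.
      apply borel_imp; auto; apply borel_const.
    + apply borel_and; [apply borel_compl, (borel_exists e a0); auto|apply borel_const].
Qed.

(** * Leaves: indices and the sets they denote *)

(** The [l]-th element of [AA x i], uniformly in [i]. *)
Definition lv (x : Pt) (i l : nat) : Rk i :=
  match i as i0 return Rk i0 with 0 => x 0 l | S j => aa x j l end.

Definition Ls : Type := sigT Rk.
Definition slev (a : Ls) : nat := projT1 a.
Definition smem (a b : Ls) : bool :=
  decb (exists j (s : Rk (S j)) (r : Rk j),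
    a = existT Rk (S j) s /\ b = existT Rk j r /\ s r).
Definition sem (x : Pt) (p : nat * nat) : Ls := existT Rk (fst p) (lv x (fst p) (snd p)).
Definition imem (x : Pt) (a b : nat * nat) : bool :=
  (fst a =? S (fst b)) && x (fst a) (snd a) (snd b).

Definition ibit (x : Pt) : nat -> tm (nat * nat) -> tm (nat * nat) -> bool :=
  bit fst (imem x).
Definition sbit : nat -> tm Ls -> tm Ls -> bool := bit slev smem.

Lemma existT_inj j (a b : Rk j) : existT Rk j a = existT Rk j b -> a = b.
Proof. apply inj_pair2_eq_dec, Nat.eq_dec. Qed.

Lemma aa_eq x j l : aa x j l = fun r => exists k, x (S j) l k = true /\ r = lv x j k.
Proof. now destruct j. Qed.

Lemma AA_eq x j : AA x j = fun r => exists k, r = lv x j k.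
Proof. now destruct j. Qed.

Lemma lt_ln_le i j n : i <= j -> lt_ln j n -> lt_ln i n.
Proof. destruct n; simpl; auto; lia. Qed.

Lemma lv_ext x i k k' : x i k = x i k' -> lv x i k = lv x i k'.
Proof.
  destruct i; simpl; auto; intros E; rewrite !aa_eq.
  now rewrite E.
Qed.

(** Induction on the level: if two rows define the same set, an element of the first has an index in
    the second; by induction both indices carry the same row, and clause (3) of [inX] moves the bit
    from one to the other. *)
Lemma lv_row n x : inX n x -> forall i k k', lt_ln i n -> lv x i k = lv x i k' -> x i k = x i k'.
Proof.
  intros Hx; induction i as [|i IH]; intros k k' Hi E; auto.
  destruct Hx as [_ Hx]; destruct (Hx (S i)) as [_ [_ H3]]; auto; [lia|].
  simpl in E; rewrite !aa_eq, ?Nat.sub_0_r in *; simpl in H3; rewrite Nat.sub_0_r in H3.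
  assert (H : forall k k', (fun r => exists m, x (S i) k m = true /\ r = lv x i m) =
      (fun r => exists m, x (S i) k' m = true /\ r = lv x i m) ->
      forall m, x (S i) k m = true -> x (S i) k' m = true).
  { intros l l' E' m Hm; apply equal_f with (lv x i m) in E'.
    assert (H : exists m', x (S i) l' m' = true /\ lv x i m = lv x i m')
      by (rewrite <- E'; eauto).
    destruct H as [m' [Hm' E'']]; apply IH in E''; [|now apply (lt_ln_le i (S i)); auto].
    now rewrite (H3 l' m m'). }
  apply functional_extensionality; intros m; apply eq_true_iff_eq; split; eauto.
Qed.

(** By [lv_row] and clause (3), the bit [x (S j) l k] depends on the set denoted by [(j, k)] and not
    on its index. *)
Lemma smem_sem n x a b : inX n x -> lt_ln (fst a) n -> smem (sem x a) (sem x b) = imem x a b.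
Proof.
  intros Hx Ha; apply eq_true_iff_eq; unfold smem, imem, sem.
  rewrite decb_true, andb_true_iff, Nat.eqb_eq; destruct a as [i l], b as [j k]; simpl in *; split.
  - intros [j' [s [r [E1 [E2 H]]]]].
    assert (E3 : i = S j') by exact (f_equal (@projT1 _ _) E1).
    assert (E4 : j = j') by exact (f_equal (@projT1 _ _) E2).
    subst; split; auto; apply existT_inj in E1; apply existT_inj in E2; subst.
    simpl in H; rewrite aa_eq in H; destruct H as [k' [Hk' E]].
    destruct (proj2 Hx (S j')) as [_ [_ H3]]; auto; [lia|]; simpl in H3; rewrite Nat.sub_0_r in H3.
    rewrite (H3 l k k'); auto; apply (lv_row n x Hx); auto.
    now apply (lt_ln_le j' (S j')); auto.
  - intros [-> H]; exists j, (lv x (S j) l), (lv x j k); repeat split; auto.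
    simpl; rewrite aa_eq; eauto.
Qed.

(** Using only the first index of each row as a leaf makes [sem] injective on leaves, while the
    choice of leaves remains Borel in [x]. *)
Definition rep (x : Pt) (a : nat * nat) : Prop :=
  forall l, l < snd a -> x (fst a) l <> x (fst a) (snd a).

Lemma rep_exists x i l : exists l', rep x (i, l') /\ x i l' = x i l.
Proof.
  induction l as [l IH] using (well_founded_induction lt_wf).
  destruct (classic (rep x (i, l))) as [H|H]; eauto.
  apply not_all_ex_not in H as [l' H]; simpl in H.
  apply imply_to_and in H as [H1 H2]; apply NNPP in H2.
  destruct (IH l' H1) as [l'' [H3 H4]]; exists l''; split; auto; congruence.
Qed.

Lemma rep_unique x i l l' : rep x (i, l) -> rep x (i, l') -> x i l = x i l' -> l = l'.
Proof.
  intros H H' E; destruct (Nat.lt_total l l') as [Hl|[Hl|Hl]]; auto; exfalso.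
  - now apply (H' l).
  - now apply (H l').
Qed.

Lemma borel_rep a : borel (fun x => rep x a).
Proof.
  unfold rep; apply (borel_forall (fun n => n) 0); [apply id_inj|]; intros l.
  apply borel_imp; [apply borel_const|]; apply borel_compl.
  apply (borel_ext (fun x => forall m, x (fst a) l m = true <-> x (fst a) (snd a) m = true)).
  - intros x; split; [intros H|now intros ->].
    apply functional_extensionality; intros m; now apply eq_true_iff_eq.
  - apply (borel_forall (fun n => n) 0); [apply id_inj|]; intros m.
    apply borel_and; apply borel_imp; apply borel_coord.
Qed.

Lemma borel_allL {L} (P : Pt -> L -> Prop) t :
  (forall a, borel (fun x => P x a)) -> borel (fun x => allL (P x) t).
Proof. intros H; induction t; simpl; auto using borel_const, borel_and. Qed.

Definition lf_ok (n : lenat) (x : Pt) (a : nat * nat) : Prop := rep x a /\ lt_ln (fst a) n.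

Lemma sem_inj n x a b : inX n x -> lf_ok n x a -> lf_ok n x b -> sem x a = sem x b -> a = b.
Proof.
  destruct a as [i l], b as [j k]; intros Hx [Ha Ha'] [Hb _] E; unfold sem in E; simpl in *.
  assert (E' : i = j) by exact (f_equal (@projT1 _ _) E); subst j.
  apply existT_inj in E; f_equal; apply (rep_unique x i); auto.
  now apply (lv_row n x).
Qed.

(** The relation computed from indices is thus intrinsic to the sets, which is the source of
    invariance of the reduction. *)
Lemma sbit_sem n x j o d : inX n x -> allL (lf_ok n x) o -> allL (lf_ok n x) d ->
  sbit j (tmap (sem x) o) (tmap (sem x) d) = ibit x j o d.
Proof.
  intros Hx; apply (bit_tmap (sem x) fst slev (imem x) smem (lf_ok n x)).
  - intros a b Ha Hb; now apply (sem_inj n x).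
  - reflexivity.
  - intros a b [_ Ha] _; now apply (smem_sem n).
Qed.

Lemma local_ibit j o d : local (fun x => ibit x j o d).
Proof.
  set (l := lvs o ++ lvs d).
  destruct (bound_list (fun a N => fst a + snd a < N) l) as [N HN];
    [intros; lia|intros a _; exists (S (fst a + snd a)); lia|].
  exists N; intros x y H.
  rewrite <- (tmap_id o), <- (tmap_id d) at 1; unfold ibit.
  apply (bit_tmap (fun a => a) fst fst (imem x) (imem y) (fun a => In a l)); auto.
  - intros a b Ha Hb; unfold imem; f_equal; apply HN in Ha; apply HN in Hb.
    apply H; lia.
  - apply allL_lvs; intros a Ha; apply in_or_app; auto.
  - apply allL_lvs; intros a Ha; apply in_or_app; auto.
Qed.

(** * The reals attached to the terms of level 0 *)

(** The final number of a dummy is a pair: its first component codes the initial segment demanded of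
    the attached real, the second is padding for size. *)
Definition pre {L} (t : tm L) : list bool :=
  match cdr (cdr (cdr t)) with
  | At i => decode (encl Nat.b2n) [] (fst (Cantor.of_nat i))
  | _ => []
  end.

Definition apx (m : nat) (a : Ls) : list bool :=
  match a with
  | existT _ i r =>
      match i as i0 return Rk i0 -> list bool with
      | 0 => fun r => prefix m r
      | S _ => fun _ => []
      end r
  end.

(** Bit [(m, c)] tells whether [c] codes the term with every real leaf cut to [m] bits. This makes
    the code injective on terms of level 0 and continuous in the leaves. *)
Definition Phi (T : tm Ls) : nat -> bool := fun v =>
  decb (enct (encl Nat.b2n) (tmap (apx (fst (Cantor.of_nat v))) T) = snd (Cantor.of_nat v)).

Definition val (G : (nat -> bool) -> nat -> bool) (T : tm Ls) : nat -> bool :=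
  ow (pre T) (G (Phi T)).

Definition lev0 (T : tm Ls) : Prop := allL (fun a => slev a = 0) T.

Lemma apx_separates a b :
  slev a = 0 -> slev b = 0 -> (forall m, apx m a = apx m b) -> a = b.
Proof.
  destruct a as [[|i] r], b as [[|j] r']; unfold slev; simpl; try discriminate; intros _ _ H.
  f_equal; apply functional_extensionality; intros m.
  rewrite <- (nth_prefix (S m) r m), <- (nth_prefix (S m) r' m) by lia.
  now rewrite H.
Qed.

Lemma tmap_apx_separates : forall T T', lev0 T -> lev0 T' ->
  (forall m, tmap (apx m) T = tmap (apx m) T') -> T = T'.
Proof.
  unfold lev0; induction T as [a|k|T IHT U IHU]; intros [a'|k'|T' U'] H H' E; simpl in *;
    try (specialize (E 0); discriminate).
  - f_equal; apply apx_separates; auto; intros m; specialize (E m); congruence.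
  - specialize (E 0); congruence.
  - f_equal; [apply IHT|apply IHU]; try tauto; intros m; specialize (E m); congruence.
Qed.

Lemma Phi_inj T T' : lev0 T -> lev0 T' -> Phi T = Phi T' -> T = T'.
Proof.
  intros H H' E; apply tmap_apx_separates; auto; intros m.
  set (e := enct (encl Nat.b2n)).
  assert (He : inj e) by apply enct_inj, encl_inj, b2n_inj.
  apply equal_f with (Cantor.to_nat (m, e (tmap (apx m) T))) in E.
  unfold Phi in E; rewrite Cantor.cancel_of_to in E; simpl in E.
  apply He; symmetry; apply decb_true; fold e in E; rewrite <- E; now apply decb_true.
Qed.

Lemma pre_tmap {L L'} (h : L -> L') t : pre (tmap h t) = pre t.
Proof. unfold pre; rewrite !tmap_cdr; now destruct (cdr (cdr (cdr t))). Qed.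

Lemma local_val G t m : (forall m c c', agree (S m) c c' -> G c m = G c' m) ->
  local (fun x => val G (tmap (sem x) t) m).
Proof.
  intros HG.
  destruct (bound_list (fun a N => snd a < N) (lvs t)) as [N HN];
    [intros; lia|intros a _; exists (S (snd a)); lia|].
  exists (S (N + m)); intros x y H; unfold val; rewrite !pre_tmap.
  unfold ow; destruct (m <? length (pre t)); auto; apply HG; intros v Hv.
  unfold Phi; rewrite !tmap_comp.
  replace (tmap (fun a => apx (fst (of_nat v)) (sem y a)) t)
    with (tmap (fun a => apx (fst (of_nat v)) (sem x a)) t); auto.
  apply tmap_ext, allL_lvs; intros [i l] Ha; apply HN in Ha; unfold sem; simpl in *.
  destruct i; simpl; auto; unfold prefix; apply map_ext_in; intros k Hk.
  apply in_seq in Hk; symmetry; apply H; try lia.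
  (* The cut length coded in [v] is at most [v], so the leaves are read within the window. *)
  pose proof (Cantor.to_nat_non_decreasing (fst (of_nat v)) (snd (of_nat v))) as H'.
  rewrite <- surjective_pairing, Cantor.cancel_to_of in H'; lia.
Qed.

(** * Density requirements on tuples of reals *)

Definition ltb_ln (i : nat) (n : lenat) : bool :=
  match n with Fin m => i <? m | Omega => true end.

Lemma ltb_ln_spec i n : ltb_ln i n = true <-> lt_ln i n.
Proof. destruct n; simpl; [apply Nat.ltb_lt|tauto]. Qed.

(** Outside the window, row [k] gets its only one among the columns from [M] on at [M + k], and
    columns below [M] are filled with ones from row [M] on. Rows and columns are then nonempty, and
    distinct rows make clause (3) trivial. *)
Lemma window_extends n M (z : Pt) :
  exists x, inX n x /\ forall i k m, lt_ln i n -> k < M -> m < M -> x i k m = z i k m.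
Proof.
  set (x i k m := if ltb_ln i n then
    (if m <? M then (if k <? M then z i k m else true) else m =? M + k) else false).
  assert (Hx : forall i k m, lt_ln i n -> M <= m -> x i k m = (m =? M + k)).
  { intros i k m Hi Hm; unfold x; apply ltb_ln_spec in Hi; rewrite Hi.
    destruct (Nat.ltb_spec m M); auto; lia. }
  exists x; split; [split|].
  - intros i Hi k m; unfold x; destruct (ltb_ln i n) eqn:E; auto.
    apply ltb_ln_spec in E; tauto.
  - intros i Hi1 Hi; split; [|split].
    + intros m; destruct (Nat.lt_ge_cases m M) as [Hm|Hm].
      * exists M; unfold x; apply ltb_ln_spec in Hi; rewrite Hi.
        destruct (Nat.ltb_spec m M); [|lia]; destruct (Nat.ltb_spec M M); auto; lia.
      * exists (m - M); rewrite Hx by auto; apply Nat.eqb_eq; lia.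
    + intros k; exists (M + k); rewrite Hx by (auto; lia); apply Nat.eqb_refl.
    + intros k l1 l2 E; replace l2 with l1; auto.
      apply equal_f with (M + l1) in E.
      rewrite !Hx, Nat.eqb_refl in E; try lia; try (apply (lt_ln_le (i - 1) i); auto; lia).
      symmetry in E; apply Nat.eqb_eq in E; lia.
  - intros i k m Hi Hk Hm; unfold x; apply ltb_ln_spec in Hi; rewrite Hi.
    destruct (Nat.ltb_spec m M), (Nat.ltb_spec k M); auto; lia.
Qed.

(* The tuples of reals that can stand in the first [t] places of level 0 of a
   point meeting [U] and having the bit pattern [l] at the higher levels. *)
Definition completes (n : lenat) (U : Pt -> Prop) (M : nat) (l : list trip) (t : nat)
    (c : nat -> nat -> bool) : Prop :=
  exists N z, inX n z /\ (forall z', near N z' z -> U z') /\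
    (forall i k m, 1 <= i -> lt_ln i n -> i < M -> k < M -> m < M ->
       z i k m = of_pattern l i k m) /\
    forall k, k < t -> agree N (z 0 k) (c k).

Lemma od_completes n U M l t (h0 : lt_ln 0 n) : is_open U -> dense_in (inX n) U ->
  od t (completes n U M l t).
Proof.
  intros Ho Hd; split.
  - intros c [N [z [H1 [H2 [H3 H4]]]]]; exists N; intros c' Hc'.
    exists N, z; split; [auto|split; [auto|split; [auto|]]].
    intros k Hk; apply (agree_trans _ _ (c k)); auto; apply agree_sym; auto.
  (* [W] covers the prescribed pattern, the required accuracy and all [t] places; [U] is then met
     near a point of the space with this window. *)
  - intros c M1; set (W := M + M1 + t).
    destruct (window_extends n W (fun i k m => if i =? 0 then c k m else of_pattern l i k m))
      as [x0 [Hx0 Ex0]].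
    destruct (Hd (fun y => near W y x0)) as [x1 [Hx1 [Nx1 Ux1]]].
    + intros y Hy; exists W; intros y' Hy' i k m Hi Hk Hm; rewrite Hy', Hy; auto.
    + exists x0; split; auto; now intros i k m.
    + destruct (Ho x1 Ux1) as [N HN]; exists (x1 0); split.
      * intros k Hk m Hm; rewrite Nx1, Ex0 by (auto; lia); reflexivity.
      * exists N, x1; split; [auto|split; [|split]]; auto.
        -- intros i k m H1 Hi HiM HkM HmM; rewrite Nx1, Ex0 by (auto; lia).
           now destruct i; [lia|].
        -- intros k Hk m Hm; reflexivity.
Qed.

(** Included among the requirements because overwriting initial segments could make two distinct
    values of [G] equal. *)
Lemma od_neq : od 2 (fun c => c 0 <> c 1).
Proof.
  split.
  - intros c Hc; apply NNPP; intros H; apply Hc, functional_extensionality; intros m.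
    apply NNPP; intros Hm; apply H; exists (S m); intros c' Hc' E; apply Hm.
    rewrite <- (Hc' 0), <- (Hc' 1), E by lia; reflexivity.
  - intros c M.
    exists (fun k m => if m <? M then c k m else k =? 0); split.
    + intros k Hk m Hm; destruct (Nat.ltb_spec m M); auto; lia.
    + intros E; apply equal_f with M in E; rewrite Nat.ltb_irrefl in E; discriminate.
Qed.

Definition mutually_generic (n : lenat) (Us : nat -> Pt -> Prop)
    (G : (nat -> bool) -> nat -> bool) : Prop :=
  (forall m c c', agree (S m) c c' -> G c m = G c' m) /\
  (forall T T', lev0 T -> lev0 T' -> val G T = val G T' -> T = T') /\
  (forall s M l ts, NoDup ts -> (forall T, In T ts -> lev0 T) ->
     completes n (Us s) M l (length ts) (fun k => val G (nth k ts (At 0)))).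

Lemma mutually_generic_exists n Us (h0 : lt_ln 0 n) :
  (forall k, is_open (Us k) /\ dense_in (inX n) (Us k)) -> exists G, mutually_generic n Us G.
Proof.
  intros HU.
  (* A countable index set of requirements: the overwritten segments, a bit choosing between
     distinctness and [completes], and the parameters of the latter. *)
  set (Q := (list (list bool) * (bool * (nat * (nat * (nat * list trip)))))%type).
  set (e := encp (encl (encl Nat.b2n)) (encp Nat.b2n (encp (fun n => n)
     (encp (fun n => n) (encp (fun n => n) (encl enc_trip))))) : Q -> nat).
  assert (He : inj e).
  { repeat apply encp_inj; repeat apply encl_inj; auto using b2n_inj, id_inj, enc_trip_inj. }
  set (q0 := ([], (true, (0, (0, (0, []))))) : Q).
  set (arity (q : Q) := let '(us, (b, (s, (M, (t, l))))) := q in if b then 2 else t).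
  set (V0 (q : Q) := let '(us, (b, (s, (M, (t, l))))) := q in
    if b then (fun c => c 0 <> c 1) else completes n (Us s) M l t).
  set (V (q : Q) := fun c : nat -> nat -> bool => V0 q (fun k => ow (nth k (fst q) []) (c k))).
  destruct (generic_family (fun k => arity (decode e q0 k)) (fun k => V (decode e q0 k)))
    as [G [HG1 HG2]].
  { intros k; destruct (decode e q0 k) as [us [b [s [M [t l]]]]]; unfold V.
    apply (od_ow _ _ (fun k => nth k us [])); simpl.
    destruct b; [apply od_neq|apply od_completes; auto; apply HU]. }
  assert (HG : forall q c, (forall k k', k < arity q -> k' < arity q -> c k = c k' -> k = k') ->
    V q (fun k => G (c k))).
  { intros q c H; specialize (HG2 (e q) c); rewrite decode_enc in HG2; auto. }
  clear HG2; exists G; split; [auto|split].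
  - intros T T' H H' E; apply NNPP; intros N.
    specialize (HG ([pre T; pre T'], (true, (0, (0, (0, [])))))
      (fun k => if k =? 0 then Phi T else Phi T')).
    unfold V in HG; simpl in HG; apply HG; [|exact E].
    assert (N' : Phi T <> Phi T') by (intros E'; apply N, Phi_inj; auto).
    intros [|[|k]] [|[|k']] Hk Hk' Ec; simpl in *; try lia; congruence.
  - intros s M l ts Hnd H0.
    specialize (HG (map pre ts, (false, (s, (M, (length ts, l)))))
      (fun k => Phi (nth k ts (At 0)))).
    unfold V in HG; simpl in HG.
    destruct HG as [N [z [H1 [H2 [H3 H4]]]]].
    + intros k k' Hk Hk' E; apply (NoDup_nth ts (At 0)); auto.
      apply Phi_inj; auto using nth_In.
    + exists N, z; split; [auto|split; [auto|split; [auto|]]].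
      intros k Hk; unfold val; specialize (H4 k Hk).
      rewrite (nth_indep _ [] (pre (@At Ls 0))), map_nth in H4; auto.
      now rewrite length_map.
Qed.

(** * Generic enumerations *)

Definition itm : Type := tm (nat * nat).
Definition obj : Type := nat * itm.
Definition state : Type := list obj.

Definition enc_obj : obj -> nat :=
  encp (fun n => n) (enct (encp (fun n => n) (fun n => n))).

Lemma enc_obj_inj : inj enc_obj.
Proof. apply encp_inj, enct_inj, encp_inj; apply id_inj. Qed.

Definition lvl (i : nat) (q : state) : list itm := map snd (filter (fun p => fst p =? i) q).

Definition valid (n : lenat) (x : Pt) (p : obj) : Prop :=
  lt_ln (fst p) n /\ allL (fun a => rep x a /\ fst a <= fst p) (snd p).

Definition view (G : (nat -> bool) -> nat -> bool) (x : Pt) (q : state) : Pt :=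
  fun i k m =>
    match i with
    | 0 => val G (tmap (sem x) (nth k (lvl 0 q) (At 0))) m
    | S j => ibit x j (nth k (lvl (S j) q) (At 0)) (nth m (lvl j q) (At 0))
    end.

Definition good (n : lenat) (x : Pt) (q : state) : Prop :=
  (forall p, In p q -> valid n x p) /\ NoDup q.

(** Membership in [U] is certified by a finite window whose positions are all occupied already, so
    later extensions of the state cannot destroy it. The bound [s < N] makes every level grow. *)
Definition meets (n : lenat) (U : Pt -> Prop) (s : nat) (q : state) (y : Pt) : Prop :=
  exists N, s < N /\ (forall i, i < N -> lt_ln i n -> N <= length (lvl i q)) /\
    forall z, (forall i k m, i < N -> k < N -> m < N ->
      z i k m = if ltb_ln i n then y i k m else false) -> U z.

Definition Ext (n : lenat) (Us : nat -> Pt -> Prop) G (s : nat) (x : Pt) (q q' : state) : Prop :=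
  (exists r, q' = q ++ r) /\ good n x q' /\
  (valid n x (decode enc_obj (0, At 0) s) -> In (decode enc_obj (0, At 0) s) q') /\
  meets n (Us s) s q' (view G x q').

Lemma lvl_app i q r : lvl i (q ++ r) = lvl i q ++ lvl i r.
Proof. unfold lvl; now rewrite filter_app, map_app. Qed.

Lemma in_lvl i q t : In t (lvl i q) <-> In (i, t) q.
Proof.
  unfold lvl; rewrite in_map_iff; split.
  - intros [[i' t'] [<- H]]; apply filter_In in H as [H1 H2]; apply Nat.eqb_eq in H2.
    simpl in *; now subst.
  - intros H; exists (i, t); split; auto; apply filter_In; split; auto; apply Nat.eqb_refl.
Qed.

Lemma NoDup_lvl i q : NoDup q -> NoDup (lvl i q).
Proof.
  induction q as [|[i' t] q IH]; intros H; [constructor|]; inversion H; subst.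
  unfold lvl; simpl; destruct (Nat.eqb_spec i' i) as [->|]; simpl; auto.
  constructor; [now rewrite (in_lvl i q t)|auto].
Qed.

Lemma lvl_one i j d : lvl i [(j, d)] = if j =? i then [d] else [].
Proof. unfold lvl; simpl; now destruct (j =? i). Qed.

Lemma length_lvl i q : length (lvl i q) <= length q.
Proof. unfold lvl; rewrite length_map; apply filter_length_le. Qed.

Lemma valid_lf_ok n x j t : valid n x (j, t) -> allL (lf_ok n x) t.
Proof.
  intros [H1 H2]; revert H2; apply allL_impl; simpl in *; intros a [H3 H4]; split; auto.
  now apply (lt_ln_le _ j).
Qed.

Fixpoint idx {A} (t : A) (l : list A) : nat :=
  match l with
  | [] => 0
  | s :: l => if excluded_middle_informative (t = s) then 0 else S (idx t l)
  end.

Lemma idx_nth {A} (l : list A) d k : NoDup l -> k < length l -> idx (nth k l d) l = k.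
Proof.
  revert k; induction l as [|s l IH]; simpl; intros k Hn Hk; [lia|]; inversion Hn; subst.
  destruct k; destruct excluded_middle_informative as [E|E]; auto; try congruence.
  - exfalso; apply H1; rewrite <- E; apply nth_In; lia.
  - f_equal; apply IH; auto; lia.
Qed.

(** Distinct representatives have distinct rows; clause (3) replaces the column where they differ by
    its representative. *)
Lemma separated n x j : inX n x -> forall a a', lf_ok n x a -> lf_ok n x a' ->
  fst a = S j -> fst a' = S j -> a <> a' ->
  exists r, lf_ok n x r /\ fst r = j /\ imem x a r <> imem x a' r.
Proof.
  intros Hx [i l] [i' l'] [H1 H2] [H3 _] E E' N; simpl in *; subst i i'.
  assert (H : exists k, x (S j) l k <> x (S j) l' k).
  { apply NNPP; intros H; apply N; f_equal; apply (rep_unique x (S j)); auto.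
    apply functional_extensionality; intros k; apply NNPP; eauto. }
  destruct H as [k Hk]; destruct (rep_exists x j k) as [k' [Hk1 Hk2]].
  destruct (proj2 Hx (S j)) as [_ [_ H4]]; auto; [lia|]; simpl in H4; rewrite Nat.sub_0_r in H4.
  exists (j, k'); split; [split; auto; now apply (lt_ln_le j (S j)); auto|].
  split; auto; unfold imem; simpl; rewrite Nat.eqb_refl; simpl.
  now rewrite (H4 l k' k), (H4 l' k' k).
Qed.

Definition matches G (x : Pt) (q : state) (z : Pt) (N : nat) : Prop :=
  (forall j k m, k < length (lvl (S j) q) -> m < length (lvl j q) ->
     view G x q (S j) k m = z (S j) k m) /\
  (forall k, k < length (lvl 0 q) -> agree N (z 0 k) (view G x q 0 k)).

Lemma extension_index n x j ss ts e e' B u : inX n x -> lt_ln j n ->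
  (forall s, In s ss -> valid n x (S j, s)) ->
  (forall t, In t ts -> exists j', valid n x (j', t) /\ j' <= j) ->
  exists d, valid n x (j, d) /\ B < sz d /\ pre d = u /\
    (forall s, In s ss -> ibit x j s d = e s) /\
    (forall t j', In t ts -> ibit x j' d t = e' t).
Proof.
  intros Hx Hj Hs Ht.
  destruct (bound_list (fun t N => sz t <= N) ts) as [B' HB']; [intros; lia|eauto|].
  (* The first component will be read by [pre]; the second makes [i] exceed both size bounds. *)
  set (i := Cantor.to_nat (encl Nat.b2n u, B + B')).
  pose proof (Cantor.to_nat_non_decreasing (encl Nat.b2n u) (B + B')) as Hi; fold i in Hi.
  destruct (extension fst (imem x) j (lf_ok n x) ss ts e e' B i) as [d [H1 [H2 [H3 [H4 H5]]]]].
  - intros a a'; now apply separated.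
  - intros s Hin; destruct (Hs s Hin) as [H1 H2]; revert H2; apply allL_impl; simpl.
    intros a [H3 H4]; repeat split; auto; now apply (lt_ln_le _ (S j)).
  - intros t Hin; destruct (Ht t Hin) as [j' [[H1 H2] Hj']]; revert H2; apply allL_impl; simpl.
    intros a [H3 H4]; repeat split; auto; [|lia]; apply (lt_ln_le _ j); auto; lia.
  - intros t Hin; specialize (HB' t Hin); lia.
  - lia.
  - exists d; repeat split; auto.
    + simpl; revert H1; apply allL_impl; intros a [[] ]; auto.
    + unfold pre; rewrite H3; unfold i; rewrite Cantor.cancel_of_to; simpl.
      apply decode_enc, encl_inj, b2n_inj.
Qed.

(** The new object takes place [K] of level [j]. Its bits against the adjacent levels, and the first
    [N] bits of its real when [j] is 0, are copied from [z] through [extension_index]. *)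
Lemma fill_one n G x q z N j : inX n x -> lt_ln j n -> good n x q -> matches G x q z N ->
  exists d, good n x (q ++ [(j, d)]) /\ matches G x (q ++ [(j, d)]) z N.
Proof.
  intros Hx Hj [Hv Hn] [Hm1 Hm2].
  destruct (bound_list (fun t B => sz t <= B) (lvl j q)) as [B HB]; [intros; lia|eauto|].
  set (K := length (lvl j q)).
  destruct (extension_index n x j (lvl (S j) q)
    (match j with 0 => [] | S j' => lvl j' q end)
    (fun s => z (S j) (idx s (lvl (S j) q)) K)
    (fun t => z j K (idx t (lvl (j - 1) q))) B (prefix N (z 0 K)))
    as [d [H1 [H2 [H3 [H4 H5]]]]]; auto.
  { intros s Hs; apply Hv; now apply in_lvl. }
  { intros t Ht; destruct j as [|j]; [easy|]; exists j; split; auto; apply Hv; now apply in_lvl. }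
  (* [d] is larger than every term already at this level. *)
  assert (Hd : ~ In d (lvl j q)) by (intros H; apply HB in H; lia).
  exists d; split; [split|split].
  - intros p Hp; apply in_app_or in Hp as [Hp|[<-|[]]]; auto.
  - apply NoDup_app; auto; [repeat constructor; auto|].
    intros p Hp [<-|[]]; apply Hd; now apply in_lvl.
  - intros j0 k m Hk Hm; specialize (Hm1 j0 k m); unfold view in *.
    rewrite lvl_app, lvl_one in Hk, Hm.
    rewrite (lvl_app j0), (lvl_app (S j0)), (lvl_one j0), (lvl_one (S j0)).
    destruct (Nat.eqb_spec j (S j0)) as [E|E]; destruct (Nat.eqb_spec j j0) as [E'|E'];
      try lia; rewrite ?app_nil_r in *.
    + rewrite length_app in Hk; simpl in Hk; subst j.
      destruct (Nat.eq_dec k K) as [->|Hne].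
      * unfold K; rewrite nth_middle, H5 by now apply nth_In.
        replace (S j0 - 1) with j0 by lia; rewrite idx_nth; auto using NoDup_lvl.
      * rewrite app_nth1; [apply Hm1; auto|]; unfold K in *; lia.
    + rewrite length_app in Hm; simpl in Hm; subst j0.
      destruct (Nat.eq_dec m K) as [->|Hne].
      * unfold K; rewrite nth_middle, H4 by now apply nth_In.
        rewrite idx_nth; auto using NoDup_lvl.
      * rewrite (app_nth1 (lvl j q)); [apply Hm1; auto|]; unfold K in *; lia.
    + apply Hm1; auto.
  - intros k Hk; unfold view in *; rewrite lvl_app, lvl_one in Hk |- *.
    destruct (Nat.eqb_spec j 0) as [E|E]; rewrite ?app_nil_r in *; auto.
    rewrite length_app in Hk; simpl in Hk; subst j.
    destruct (Nat.eq_dec k K) as [->|Hne].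
    + unfold K at 2; rewrite nth_middle; intros m HmN; unfold val, ow.
      rewrite pre_tmap, H3; unfold prefix at 1; rewrite length_map, length_seq.
      destruct (Nat.ltb_spec m N); [|lia]; now rewrite nth_prefix.
    + rewrite app_nth1; [apply Hm2|]; unfold K in *; lia.
Qed.

Lemma fill_level n G x z N j c : inX n x -> lt_ln j n -> forall q,
  good n x q -> matches G x q z N ->
  exists r, good n x (q ++ r) /\ matches G x (q ++ r) z N /\ c <= length (lvl j (q ++ r)).
Proof.
  intros Hx Hj q Hg Hm; induction c as [|c [r [H1 [H2 H3]]]].
  - exists []; rewrite app_nil_r; split; [auto|split; [auto|lia]].
  - destruct (fill_one n G x (q ++ r) z N j) as [d [H4 H5]]; auto.
    exists (r ++ [(j, d)]); rewrite app_assoc; split; auto; split; auto.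
    rewrite lvl_app, lvl_one, Nat.eqb_refl, length_app; simpl; lia.
Qed.

Lemma fill_levels n G x z N c I : inX n x -> forall q, good n x q -> matches G x q z N ->
  exists r, good n x (q ++ r) /\ matches G x (q ++ r) z N /\
    forall i, i < I -> lt_ln i n -> c <= length (lvl i (q ++ r)).
Proof.
  intros Hx q Hg Hm; induction I as [|I [r [H1 [H2 H3]]]].
  - exists []; rewrite app_nil_r; split; [auto|split; [auto|lia]].
  - destruct (classic (lt_ln I n)) as [HI|HI].
    + destruct (fill_level n G x z N I c Hx HI (q ++ r)) as [r' [H4 [H5 H6]]]; auto.
      exists (r ++ r'); rewrite app_assoc; split; [auto|split; [auto|]].
      intros i Hi Hn; destruct (Nat.eq_dec i I) as [->|Hne]; auto.
      rewrite lvl_app, length_app; specialize (H3 i); etransitivity; [apply H3; auto; lia|lia].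
    + exists r; split; [auto|split; [auto|]].
      intros i Hi Hn; apply H3; auto; destruct (Nat.eq_dec i I); [subst; tauto|lia].
Qed.

(** The reals already enumerated cannot be changed, but they are mutually generic: some [z] well
    inside [Us s] agrees with them up to [N] and with all bits decided so far. It remains to add
    objects copying [z] until the window is full. *)
Lemma fill_generic n Us G x q s : inX n x -> mutually_generic n Us G -> good n x q ->
  exists r, good n x (q ++ r) /\ meets n (Us s) s (q ++ r) (view G x (q ++ r)).
Proof.
  intros Hx [_ [_ HG]] Hg.
  destruct (bound_list (fun p B => fst p < B) q) as [M HM];
    [intros; lia|intros p _; exists (S (fst p)); lia|].
  set (W := M + length q).
  assert (HW : forall i k, k < length (lvl i q) -> i < W /\ k < W).
  { intros i k Hk; pose proof (length_lvl i q).
    assert (Hk' : In (i, nth k (lvl i q) (At 0)) q) by now apply in_lvl, nth_In.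
    apply HM in Hk'; simpl in Hk'; unfold W; lia. }
  set (ts := map (tmap (sem x)) (lvl 0 q)).
  destruct (HG s W (pattern W (view G x q)) ts) as [N [z [Hz1 [Hz2 [Hz3 Hz4]]]]].
  { unfold ts; apply NoDup_map_NoDup_ForallPairs; [|apply NoDup_lvl, Hg].
    intros t t' Ht Ht' E; revert E; apply (tmap_inj (sem x) (lf_ok n x)).
    - intros a b Ha Hb; now apply (sem_inj n).
    - apply (valid_lf_ok n x 0), Hg; now apply in_lvl.
    - apply (valid_lf_ok n x 0), Hg; now apply in_lvl. }
  { intros T HT; apply in_map_iff in HT as [t [<- Ht]]; apply in_lvl, Hg in Ht as [_ Ht].
    unfold lev0; rewrite allL_tmap; revert Ht; apply allL_impl; simpl; intros a [_ H]; lia. }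
  assert (Hts : forall k, k < length (lvl 0 q) ->
    val G (nth k ts (At 0)) = view G x q 0 k).
  { intros k Hk; unfold view, ts.
    now rewrite (nth_indep _ (At 0) (tmap (sem x) (At 0))), map_nth by now rewrite length_map. }
  unfold ts in Hz4; rewrite length_map in Hz4; fold ts in Hz4.
  (* The target is corrected to the actual reals at occupied places: these match [z] only on [N]
     bits, whereas the filling works with the larger [N']. *)
  set (z' i k m := if (i =? 0) && (k <? length (lvl 0 q)) then view G x q 0 k m else z i k m).
  set (N' := N + S s).
  destruct (fill_levels n G x z' N' N' N' Hx q Hg) as [r [H1 [H2 H3]]].
  { split.
    - intros j k m Hk Hm; unfold z'; simpl (S j =? 0); cbn [andb].
      pose proof (HW _ _ Hk); pose proof (HW _ _ Hm).
      rewrite Hz3 by (try lia; apply (proj1 Hg (S j, nth k (lvl (S j) q) (At 0)));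
        apply in_lvl; now apply nth_In).
      symmetry; apply near_pattern; lia.
    - intros k Hk m _; unfold z'; simpl.
      destruct (Nat.ltb_spec k (length (lvl 0 q))); auto; lia. }
  exists r; split; auto; exists N'; split; [unfold N'; lia|split; [auto|]].
  intros y Hy; apply Hz2; intros i k m Hi Hk Hm.
  rewrite Hy by (unfold N'; lia).
  destruct (ltb_ln i n) eqn:E.
  - apply ltb_ln_spec in E.
    assert (Hlen : forall i', i' <= i -> N' <= length (lvl i' (q ++ r))).
    { intros i' Hi'; apply H3; [unfold N'; lia|]; now apply (lt_ln_le i' i). }
    transitivity (z' i k m).
    + destruct H2 as [H2 H2']; destruct i as [|j].
      * symmetry; apply H2'; [specialize (Hlen 0)|]; unfold N' in *; lia.
      * pose proof (Hlen (S j)); pose proof (Hlen j); apply H2; unfold N' in *; lia.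
    + unfold z'; destruct (Nat.eqb_spec i 0) as [->|]; auto; cbn [andb].
      destruct (Nat.ltb_spec k (length (lvl 0 q))) as [Hk'|]; auto.
      rewrite <- Hts by auto; symmetry; apply Hz4; auto.
  - symmetry; apply Hz1; rewrite <- ltb_ln_spec; now rewrite E.
Qed.

Lemma Ext_exists n Us G s x q : inX n x -> mutually_generic n Us G -> good n x q ->
  exists q', Ext n Us G s x q q'.
Proof.
  intros Hx HG Hg; set (p := decode enc_obj (0, At 0) s).
  assert (H : exists r, good n x (q ++ r) /\ (valid n x p -> In p (q ++ r))).
  { destruct (classic (valid n x p /\ ~ In p q)) as [[H1 H2]|H].
    - exists [p]; split; [split|].
      + intros p' Hp'; apply in_app_or in Hp' as [Hp'|[<-|[]]]; auto; now apply Hg.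
      + apply NoDup_app; [apply Hg|repeat constructor; auto|].
        intros p' Hp' [<-|[]]; auto.
      + intros _; apply in_or_app; simpl; auto.
    - exists []; rewrite app_nil_r; split; auto; intros H1; apply NNPP; tauto. }
  destruct H as [r [H1 H2]].
  destruct (fill_generic n Us G x (q ++ r) s) as [r' [H3 H4]]; auto.
  exists ((q ++ r) ++ r'); split; [exists (r ++ r'); now rewrite app_assoc|].
  split; auto; split; auto; intros Hp; apply in_or_app; left; now apply H2.
Qed.

(** * The reduction: measurability and values *)

Fixpoint st (n : lenat) Us G (x : Pt) (s : nat) : state :=
  match s with
  | 0 => []
  | S s => pick (encl enc_obj) [] (Ext n Us G s x (st n Us G x s))
  end.

(** By stage [S (i + k + m)] the positions needed for this entry are occupied, and they never change
    afterwards. *)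
Definition red (n : lenat) Us G (x : Pt) : Pt := fun i k m =>
  if ltb_ln i n then view G x (st n Us G x (S (i + k + m))) i k m else false.

Definition ob (n : lenat) Us G (x : Pt) (j k : nat) : itm :=
  nth k (lvl j (st n Us G x (S (j + k)))) (At 0).

Lemma borel_valid n p : borel (fun x => valid n x p).
Proof.
  unfold valid; apply borel_and; [apply borel_const|]; apply borel_allL; intros a.
  apply borel_and; [apply borel_rep|apply borel_const].
Qed.

Lemma borel_good n q : borel (fun x => good n x q).
Proof.
  apply borel_and; [|apply borel_const].
  apply (borel_forall enc_obj (0, At 0)); [apply enc_obj_inj|]; intros p.
  apply borel_imp; auto using borel_const, borel_valid.
Qed.

Lemma local_view G q i k m : (forall m c c', agree (S m) c c' -> G c m = G c' m) ->
  local (fun x => view G x q i k m).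
Proof. intros HG; destruct i; simpl; [now apply local_val|apply local_ibit]. Qed.

(** The condition is even open: a finite window of the view depends on finitely many bits of [x]. *)
Lemma borel_meets n U G s q : (forall m c c', agree (S m) c c' -> G c m = G c' m) ->
  borel (fun x => meets n U s q (view G x q)).
Proof.
  intros HG; apply borel_open; intros x [N [H1 [H2 H3]]].
  destruct (bound_list (fun (p : trip) B => forall y, near B y x ->
      view G y q (fst p) (fst (snd p)) (snd (snd p)) =
      view G x q (fst p) (fst (snd p)) (snd (snd p))) (cube N)) as [B HB].
  - intros p B B' HBB H y Hy; apply H; now apply (near_le B B').
  - intros [i [k m]] _; destruct (local_view G q i k m HG) as [B HB]; exists B; auto.
  - exists B; intros y Hy; exists N; split; [auto|split; [auto|]]; intros z Hz; apply H3.
    intros i k m Hi Hk Hm; rewrite Hz by auto; destruct (ltb_ln i n); auto.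
    apply (HB (i, (k, m))); auto; now apply in_cube.
Qed.

Lemma borel_Ext n Us G s q q' : (forall m c c', agree (S m) c c' -> G c m = G c' m) ->
  borel (fun x => Ext n Us G s x q q').
Proof.
  intros HG; unfold Ext.
  apply borel_and; [apply borel_const|apply borel_and; [apply borel_good|apply borel_and]].
  - apply borel_imp; auto using borel_const, borel_valid.
  - now apply borel_meets.
Qed.

(** There are countably many states, so each step splits over the possible values of the preceding
    state. *)
Lemma borel_st n Us G s : (forall m c c', agree (S m) c c' -> G c m = G c' m) ->
  forall q, borel (fun x => st n Us G x s = q).
Proof.
  intros HG; induction s as [|s IH]; intros q; simpl; [apply borel_const|].
  assert (He : inj (encl enc_obj)) by apply encl_inj, enc_obj_inj.
  apply (borel_ext (fun x => exists q0, st n Us G x s = q0 /\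
    pick (encl enc_obj) [] (Ext n Us G s x q0) = q)).
  - intros x; split; [now intros [q0 [-> H]]|eauto].
  - apply (borel_exists (encl enc_obj) []); auto; intros q0.
    apply borel_and; auto; apply borel_pick; auto; intros; now apply borel_Ext.
Qed.

Lemma borel_red n Us G i k m : (forall m c c', agree (S m) c c' -> G c m = G c' m) ->
  borel (fun x => red n Us G x i k m = true).
Proof.
  intros HG; unfold red; destruct (ltb_ln i n); [|apply borel_const].
  assert (He : inj (encl enc_obj)) by apply encl_inj, enc_obj_inj.
  apply (borel_ext (fun x => exists q, st n Us G x (S (i + k + m)) = q /\
    view G x q i k m = true)).
  - intros x; split; [now intros [q [-> H]]|eauto].
  - apply (borel_exists (encl enc_obj) []); auto; intros q.
    apply borel_and; [now apply borel_st|]; now apply borel_local, local_view.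
Qed.

Lemma st_spec n Us G x s : inX n x -> mutually_generic n Us G ->
  good n x (st n Us G x s) /\ Ext n Us G s x (st n Us G x s) (st n Us G x (S s)).
Proof.
  intros Hx HG.
  assert (H : forall s, good n x (st n Us G x s) ->
    Ext n Us G s x (st n Us G x s) (st n Us G x (S s))).
  { intros s' H; apply (pick_least (encl enc_obj) [] (Ext n Us G s' x (st n Us G x s'))).
    now apply Ext_exists. }
  assert (Hs : good n x (st n Us G x s)); [|auto].
  induction s as [|s IH]; [split; [intros p []|constructor]|].
  now destruct (H s IH) as [_ [H1 _]].
Qed.

Lemma st_app n Us G x s d : inX n x -> mutually_generic n Us G ->
  exists r, st n Us G x (d + s) = st n Us G x s ++ r.
Proof.
  intros Hx HG; induction d as [|d [r IH]]; [exists []; now rewrite app_nil_r|].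
  destruct (st_spec n Us G x (d + s) Hx HG) as [_ [[r' H] _]].
  exists (r ++ r'); change (S d + s) with (S (d + s)); now rewrite H, IH, app_assoc.
Qed.

Lemma st_length n Us G x s i : inX n x -> mutually_generic n Us G -> lt_ln i n -> i <= s ->
  S s <= length (lvl i (st n Us G x (S s))).
Proof.
  intros Hx HG Hi His; destruct (st_spec n Us G x s Hx HG) as [_ [_ [_ [_ [N [H1 [H2 _]]]]]]].
  specialize (H2 i); assert (N <= length (lvl i (st n Us G x (S s)))) by (apply H2; auto; lia).
  lia.
Qed.

Lemma ob_nth n Us G x s j k : inX n x -> mutually_generic n Us G -> lt_ln j n ->
  k < length (lvl j (st n Us G x s)) -> nth k (lvl j (st n Us G x s)) (At 0) = ob n Us G x j k.
Proof.
  intros Hx HG Hj Hk; unfold ob; set (s' := S (j + k)).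
  assert (Hk' : k < length (lvl j (st n Us G x s'))).
  { pose proof (st_length n Us G x (j + k) j Hx HG Hj); unfold s'; lia. }
  destruct (Nat.le_gt_cases s s') as [H|H].
  - destruct (st_app n Us G x s (s' - s) Hx HG) as [r E].
    replace (s' - s + s) with s' in E by lia; now rewrite E, lvl_app, app_nth1.
  - destruct (st_app n Us G x s' (s - s') Hx HG) as [r E].
    replace (s - s' + s') with s in E by lia; now rewrite E, lvl_app, app_nth1.
Qed.

Lemma ob_valid n Us G x j k : inX n x -> mutually_generic n Us G -> lt_ln j n ->
  valid n x (j, ob n Us G x j k).
Proof.
  intros Hx HG Hj; apply (proj1 (proj1 (st_spec n Us G x (S (j + k)) Hx HG))).
  apply in_lvl, nth_In; pose proof (st_length n Us G x (j + k) j Hx HG Hj); lia.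
Qed.

Lemma ob_surj n Us G x j t : inX n x -> mutually_generic n Us G -> valid n x (j, t) ->
  exists k, ob n Us G x j k = t.
Proof.
  (* Stage [s] is the one at which [Ext] requires the object with code [s]. *)
  intros Hx HG Ht; set (s := enc_obj (j, t)).
  destruct (st_spec n Us G x s Hx HG) as [_ [_ [_ [H _]]]].
  unfold s in H at 1 2; rewrite decode_enc in H by apply enc_obj_inj.
  specialize (H Ht); apply in_lvl, (In_nth _ _ (At 0)) in H as [k [Hk E]].
  exists k; now rewrite <- (ob_nth n Us G x (S s) j k Hx HG (proj1 Ht) Hk).
Qed.

Lemma view_stage n Us G x s i k m : inX n x -> mutually_generic n Us G -> lt_ln i n ->
  k < length (lvl i (st n Us G x s)) -> m < length (lvl (i - 1) (st n Us G x s)) \/ i = 0 ->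
  view G x (st n Us G x s) i k m =
  match i with
  | 0 => val G (tmap (sem x) (ob n Us G x 0 k)) m
  | S j => ibit x j (ob n Us G x (S j) k) (ob n Us G x j m)
  end.
Proof.
  intros Hx HG Hi Hk Hm; unfold view; destruct i as [|j].
  - now rewrite ob_nth.
  - simpl in Hm; rewrite Nat.sub_0_r in Hm.
    assert (lt_ln j n) by (apply (lt_ln_le j (S j)); auto).
    rewrite !ob_nth; auto; destruct Hm; auto; discriminate.
Qed.

Lemma red_eq n Us G x i k m : inX n x -> mutually_generic n Us G -> lt_ln i n ->
  red n Us G x i k m =
  match i with
  | 0 => val G (tmap (sem x) (ob n Us G x 0 k)) m
  | S j => ibit x j (ob n Us G x (S j) k) (ob n Us G x j m)
  end.
Proof.
  intros Hx HG Hi; unfold red; apply ltb_ln_spec in Hi as Hi'; rewrite Hi'.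
  apply (view_stage n); auto.
  - pose proof (st_length n Us G x (i + k + m) i Hx HG Hi); lia.
  - left; pose proof (st_length n Us G x (i + k + m) (i - 1) Hx HG).
    assert (lt_ln (i - 1) n) by (apply (lt_ln_le _ i); auto; lia).
    assert (S (i + k + m) <= length (lvl (i - 1) (st n Us G x (S (i + k + m))))) by
      (apply H; auto; lia); lia.
Qed.

Lemma red_generic n Us G x s : inX n x -> mutually_generic n Us G -> Us s (red n Us G x).
Proof.
  intros Hx HG; destruct (st_spec n Us G x s Hx HG) as [_ [_ [_ [_ [N [H1 [H2 H3]]]]]]].
  apply H3; intros i k m Hi Hk Hm; destruct (ltb_ln i n) eqn:E.
  - apply ltb_ln_spec in E; rewrite red_eq, view_stage; auto.
    + specialize (H2 i Hi E); lia.
    + left; assert (N <= length (lvl (i - 1) (st n Us G x (S s)))); [|lia].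
      apply H2; [lia|]; apply (lt_ln_le _ i); auto; lia.
  - unfold red; now rewrite E.
Qed.

Lemma red_inX n Us G x : inX n x -> mutually_generic n Us G -> inX n (red n Us G x).
Proof.
  intros Hx HG; split.
  - intros i Hi k m; unfold red; destruct (ltb_ln i n) eqn:E; auto.
    apply ltb_ln_spec in E; tauto.
  - intros i Hi1 Hi; destruct i as [|j]; [lia|]; simpl; rewrite Nat.sub_0_r.
    assert (Hj : lt_ln j n) by (apply (lt_ln_le j (S j)); auto).
    split; [|split].
    + intros m; destruct (extension_index n x (S j) [] [ob n Us G x j m]
        (fun _ => true) (fun _ => true) 0 []) as [d [H1 [_ [_ [_ H2]]]]]; auto.
      * intros ? [].
      * intros t [<-|[]]; exists j; split; auto; now apply ob_valid.
      * destruct (ob_surj n Us G x (S j) d Hx HG H1) as [k Hk].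
        exists k; rewrite red_eq, Hk by auto; apply H2; simpl; auto.
    + intros k; destruct (extension_index n x j [ob n Us G x (S j) k] []
        (fun _ => true) (fun _ => true) 0 []) as [d [H1 [_ [_ [H2 _]]]]]; auto.
      * intros t [<-|[]]; now apply ob_valid.
      * intros ? [].
      * destruct (ob_surj n Us G x j d Hx HG H1) as [m Hm].
        exists m; rewrite red_eq, Hm by auto; apply H2; simpl; auto.
    + intros k l1 l2 E; rewrite !red_eq by auto; f_equal.
      (* Clause (3) holds since equal rows come from equal terms: at level 0 by injectivity of
         [val], above by an object of the level below realising a pattern that separates the two
         terms. *)
      destruct j as [|j].
      * assert (E' : val G (tmap (sem x) (ob n Us G x 0 l1)) =
            val G (tmap (sem x) (ob n Us G x 0 l2))).
        { apply functional_extensionality; intros m; apply equal_f with m in E.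
          now rewrite !red_eq in E. }
        pose proof (ob_valid n Us G x 0 l1 Hx HG Hj) as V1.
        pose proof (ob_valid n Us G x 0 l2 Hx HG Hj) as V2.
        apply HG in E'.
        -- revert E'; apply (tmap_inj (sem x) (lf_ok n x)); eauto using valid_lf_ok.
           intros a b Ha Hb; now apply (sem_inj n).
        -- unfold lev0; rewrite allL_tmap; eapply allL_impl; [|apply V1].
           intros a [_ Ha]; simpl in *; lia.
        -- unfold lev0; rewrite allL_tmap; eapply allL_impl; [|apply V2].
           intros a [_ Ha]; simpl in *; lia.
      * apply NNPP; intros N.
        destruct (extension_index n x j [ob n Us G x (S j) l1; ob n Us G x (S j) l2] []
          (fun t => decb (t = ob n Us G x (S j) l1)) (fun _ => true) 0 [])
          as [d [H1 [_ [_ [H2 _]]]]]; auto.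
        -- now apply (lt_ln_le j (S j)); auto.
        -- intros t [<-|[<-|[]]]; now apply ob_valid.
        -- intros ? [].
        -- destruct (ob_surj n Us G x j d Hx HG H1) as [m Hm].
           apply equal_f with m in E; rewrite !red_eq, Hm, !H2 in E by (simpl; auto).
           apply N; symmetry; apply decb_true; rewrite <- E; now apply decb_true.
Qed.

(** * The sets coded by the enumerated terms *)

Definition Os (A : forall i, Rk i -> Prop) (j : nat) (T : tm Ls) : Prop :=
  allL (fun a => A (projT1 a) (projT2 a) /\ slev a <= j) T.

(** The point [x] enters only through the family [A]; indices and the order of enumeration have
    disappeared. *)
Fixpoint BB G (A : forall i, Rk i -> Prop) (j : nat) (T : tm Ls) : Rk j :=
  match j as j0 return Rk j0 with
  | 0 => val G T
  | S j => fun r => exists T', Os A j T' /\ sbit j T T' = true /\ r = BB G A j T'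
  end.

Lemma Os_sem n x j t : valid n x (j, t) -> Os (AA x) j (tmap (sem x) t).
Proof.
  intros [H1 H2]; unfold Os; rewrite allL_tmap; revert H2; apply allL_impl.
  intros a [_ H3]; split; auto; simpl; rewrite AA_eq; eauto.
Qed.

Lemma Os_surj n x j T : lt_ln j n -> Os (AA x) j T ->
  exists t, valid n x (j, t) /\ tmap (sem x) t = T.
Proof.
  intros Hj HT; destruct (tmap_surj (sem x) (fun a => rep x a /\ fst a <= j) T) as [t [H1 H2]].
  - revert HT; apply allL_impl; intros [i r] [H1 H2]; simpl in *; rewrite AA_eq in H1.
    destruct H1 as [k ->]; destruct (rep_exists x i k) as [k' [H3 H4]].
    exists (i, k'); repeat split; auto; unfold sem; simpl; now rewrite (lv_ext x i k' k).
  - exists t; repeat split; auto.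
Qed.

(** The enumeration exhausts the valid terms, and these denote exactly the objects in [Os], so a row
    of the reduction lists all related objects one level below. *)
Lemma lv_red n Us G x : inX n x -> mutually_generic n Us G -> forall j k, lt_ln j n ->
  lv (red n Us G x) j k = BB G (AA x) j (tmap (sem x) (ob n Us G x j k)).
Proof.
  intros Hx HG; induction j as [|j IH]; intros k Hj.
  - simpl; apply functional_extensionality; intros m; now rewrite red_eq.
  - assert (Hj' : lt_ln j n) by (apply (lt_ln_le j (S j)); auto).
    assert (Hb : forall t, valid n x (j, t) ->
      sbit j (tmap (sem x) (ob n Us G x (S j) k)) (tmap (sem x) t) =
      ibit x j (ob n Us G x (S j) k) t).
    { intros t Ht; apply (sbit_sem n); eauto using valid_lf_ok.
      apply (valid_lf_ok n x (S j)); now apply ob_valid. }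
    simpl; rewrite aa_eq; apply functional_extensionality; intros r.
    apply propositional_extensionality; split.
    + intros [m [H1 ->]]; rewrite red_eq in H1 by auto.
      assert (V : valid n x (j, ob n Us G x j m)) by now apply ob_valid.
      exists (tmap (sem x) (ob n Us G x j m)); split; [now apply (Os_sem n)|].
      rewrite Hb; auto.
    + intros [T [H1 [H2 ->]]]; destruct (Os_surj n x j T Hj' H1) as [t [V <-]].
      destruct (ob_surj n Us G x j t Hx HG V) as [m <-]; exists m.
      rewrite red_eq, <- Hb by auto; split; [|symmetry]; auto.
Qed.

(** The right-hand side depends on [AA x] alone, which gives the forward implication of the
    reduction. *)
Lemma AA_red n Us G x : inX n x -> mutually_generic n Us G -> forall j, lt_ln j n ->
  AA (red n Us G x) j = fun r => exists T, Os (AA x) j T /\ r = BB G (AA x) j T.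
Proof.
  intros Hx HG j Hj; rewrite AA_eq; apply functional_extensionality; intros r.
  apply propositional_extensionality; split.
  - intros [k ->]; rewrite (lv_red n) by auto; eexists; split; [|reflexivity].
    apply (Os_sem n); now apply ob_valid.
  - intros [T [H1 ->]]; destruct (Os_surj n x j T Hj H1) as [t [V <-]].
    destruct (ob_surj n Us G x j t Hx HG V) as [k <-]; exists k; now rewrite (lv_red n).
Qed.

(** * Recovering the coded sets *)

Lemma AA_beyond n x j : inX n x -> lt_ln 0 n -> ~ lt_ln j n ->
  AA x j = match j as j0 return Rk (S j0) with
           | 0 => fun _ => False
           | S j => fun s => s = fun _ => False end.
Proof.
  intros [Hx _] H0 Hj; destruct j as [|j]; [tauto|]; rewrite AA_eq; simpl.
  assert (E : forall k, aa x j k = fun _ => False).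
  { intros k; rewrite aa_eq; apply functional_extensionality; intros r.
    apply propositional_extensionality; split; [|tauto].
    intros [m [H _]]; rewrite Hx in H; auto; discriminate. }
  apply functional_extensionality; intros s; apply propositional_extensionality; split.
  - intros [k ->]; auto.
  - intros ->; exists 0; auto.
Qed.

(** By clause (1), [AA x j] is the union of [AA x (S j)]. *)
Lemma AA_pred n x y j : inX n x -> inX n y -> lt_ln (S j) n ->
  AA x (S j) = AA y (S j) -> AA x j = AA y j.
Proof.
  assert (H : forall x y, inX n x -> lt_ln (S j) n -> AA x (S j) = AA y (S j) ->
    forall r, AA x j r -> AA y j r).
  { clear; intros x y Hx Hj E r Hr; rewrite AA_eq in Hr |- *; destruct Hr as [k ->].
    destruct (proj2 Hx (S j)) as [H _]; auto; [lia|]; destruct (H k) as [l Hl].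
    assert (Hl' : AA y (S j) (aa x j l)) by (rewrite <- E, AA_eq; now exists l).
    rewrite AA_eq in Hl'; destruct Hl' as [l' El]; simpl in El.
    assert (Hk : aa y j l' (lv x j k)) by (rewrite <- El, aa_eq; eauto).
    rewrite aa_eq in Hk.
    destruct Hk as [k' [_ ->]]; eauto. }
  intros Hx Hy Hj E; apply functional_extensionality; intros r.
  apply propositional_extensionality; split; eauto.
Qed.

Lemma F_AA n x y : lt_ln 0 n -> inX n x -> inX n y ->
  (F n x y <-> forall j, AA x j = AA y j).
Proof.
  intros H0 Hx Hy; split; [|destruct n; simpl; auto].
  intros HF j; destruct (classic (lt_ln j n)) as [Hj|Hj].
  - destruct n as [m|]; [|apply HF]; simpl in *.
    (* Descending induction from the top level [m - 1]. *)
    replace j with (m - 1 - (m - 1 - j)) by lia.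
    assert (Hd : m - 1 - j < m) by lia; revert Hd.
    induction (m - 1 - j) as [|d IH]; intros Hd; [now rewrite Nat.sub_0_r|].
    destruct (Nat.le_gt_cases (m - 1) d) as [H|H].
    + replace (m - 1 - S d) with (m - 1 - d) by lia; apply IH; lia.
    + apply (AA_pred (Fin m)); auto; [simpl; lia|].
      replace (S (m - 1 - S d)) with (m - 1 - d) by lia; apply IH; lia.
  - now rewrite (AA_beyond n x), (AA_beyond n y).
Qed.

Lemma Os_leaf A j (a : Rk j) : Os A j (Lf (existT Rk j a)) <-> A j a.
Proof. unfold Os, slev; simpl; intuition. Qed.

(* Members of [AA x (S j)] are subsets of [AA x j], so two of them are separated
   by a member of [AA x j] even when they come from different points. *)
Lemma smem_separated x y j : AA x j = AA y j -> forall a a' : Ls,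
  AA x (projT1 a) (projT2 a) \/ AA y (projT1 a) (projT2 a) ->
  AA x (projT1 a') (projT2 a') \/ AA y (projT1 a') (projT2 a') ->
  slev a = S j -> slev a' = S j -> a <> a' ->
  exists r : Ls, AA x (projT1 r) (projT2 r) /\ slev r = j /\ smem a r <> smem a' r.
Proof.
  unfold slev; intros E [i a] [i' a'] Ha Ha' Ei Ei' N; simpl in *; subst i i'.
  assert (Hs : forall b, AA x (S j) b \/ AA y (S j) b -> forall r, b r -> AA x j r).
  { clear -E; intros b [Hb|Hb] r Hr; rewrite AA_eq in Hb; simpl in Hb; destruct Hb as [k ->];
      rewrite aa_eq in Hr; destruct Hr as [m [_ ->]]; [|rewrite E]; rewrite AA_eq; eauto. }
  assert (Hm : forall (b : Rk (S j)) r, smem (existT Rk (S j) b) (existT Rk j r) = true <-> b r).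
  { intros b r; unfold smem; rewrite decb_true; split; [|eauto 8].
    intros [j' [s [r' [E1 [E2 H]]]]].
    assert (Ej : j = j') by exact (f_equal (@projT1 _ _) E2); subst j'.
    apply existT_inj in E1; apply existT_inj in E2; now subst. }
  assert (H : exists r, ~ (a r <-> a' r)).
  { apply NNPP; intros H; apply N; f_equal; apply functional_extensionality; intros r.
    apply propositional_extensionality, NNPP; eauto. }
  destruct H as [r Hr]; exists (existT Rk j r); simpl; split; [|split; auto].
  - apply NNPP; intros H; apply Hr; split; intros H'; exfalso; apply H; eauto.
  - intros Em; apply Hr; rewrite <- !Hm, Em; tauto.
Qed.

(** Both claims are proved together by induction on [j]. Injectivity of [BB] across the two points
    gives equality of the families: for [a] in [AA x j] the leaf [Lf a] is an object, its set also
    comes from an object over [AA y], and that object must be the same leaf. *)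
Lemma AA_reflects n Us G x y : inX n x -> inX n y -> mutually_generic n Us G ->
  (forall j, AA (red n Us G x) j = AA (red n Us G y) j) ->
  forall j, lt_ln j n -> (forall i, i <= j -> AA x i = AA y i) /\
    (forall T T', Os (AA x) j T -> Os (AA y) j T' ->
       BB G (AA x) j T = BB G (AA y) j T' -> T = T').
Proof.
  intros Hx Hy HG E.
  assert (Hsub : forall x y j, inX n x -> inX n y ->
    AA (red n Us G x) j = AA (red n Us G y) j -> lt_ln j n ->
    (forall T T', Os (AA x) j T -> Os (AA y) j T' ->
       BB G (AA x) j T = BB G (AA y) j T' -> T = T') -> forall a : Rk j, AA x j a -> AA y j a).
  { clear -HG; intros x y j Hx Hy E Hj Hi a Ha.
    assert (H : AA (red n Us G y) j (BB G (AA x) j (Lf (existT Rk j a)))).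
    { rewrite <- E, (AA_red n) by auto; eexists; split; [|reflexivity]; now apply Os_leaf. }
    rewrite (AA_red n) in H by auto.
    destruct H as [T [H1 H2]]; apply Hi in H2; auto; [|now apply Os_leaf].
    subst T; now apply Os_leaf. }
  assert (Heq : forall j, lt_ln j n ->
    (forall T T', Os (AA x) j T -> Os (AA y) j T' ->
       BB G (AA x) j T = BB G (AA y) j T' -> T = T') -> AA x j = AA y j).
  { intros j Hj Hi; apply functional_extensionality; intros a.
    apply propositional_extensionality; split; apply Hsub; auto.
    intros T T' H H' E'; symmetry; auto. }
  induction j as [|j IH]; intros Hj.
  - assert (Hi : forall T T', Os (AA x) 0 T -> Os (AA y) 0 T' ->
       BB G (AA x) 0 T = BB G (AA y) 0 T' -> T = T').
    { intros T T' H H' E'; apply HG; auto.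
      - revert H; apply allL_impl; intros a [_ H]; lia.
      - revert H'; apply allL_impl; intros a [_ H']; lia. }
    split; auto; intros i Hi0; replace i with 0 by lia; auto.
  - assert (Hj' : lt_ln j n) by (apply (lt_ln_le j (S j)); auto).
    destruct (IH Hj') as [IH1 IH2].
    assert (Hi : forall T T', Os (AA x) (S j) T -> Os (AA y) (S j) T' ->
       BB G (AA x) (S j) T = BB G (AA y) (S j) T' -> T = T').
    { intros T T' H H' E'; apply NNPP; intros N.
      set (P (a : Ls) := AA x (projT1 a) (projT2 a) \/ AA y (projT1 a) (projT2 a)).
      (* [D] is related to [T] but not to [T']. Leaves of either family are allowed in [P] because
         the families are not yet known to agree at level [S j]; those of [D] have level at most
         [j], where they do. *)
      destruct (extension slev smem j P [T; T'] [] (fun t => decb (t = T)) (fun _ => true) 0 0)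
        as [D [H1 [_ [_ [H2 _]]]]]; auto.
      - intros a a' Ha Ha' La La' Na.
        destruct (smem_separated x y j (IH1 j (le_n j)) a a') as [r [H1 H2]]; auto.
        exists r; split; auto; now left.
      - intros t [<-|[<-|[]]]; [revert H|revert H']; apply allL_impl; unfold P; tauto.
      - intros ? [].
      - intros ? [].
      - assert (HD : Os (AA x) j D).
        { revert H1; apply allL_impl; intros [i a] [[H1|H1] H3]; split; auto.
          unfold slev in H3; simpl in *; now rewrite IH1. }
        assert (HT : sbit j T D = true).
        { unfold sbit; rewrite H2 by (simpl; auto); now apply decb_true. }
        assert (H3 : BB G (AA y) (S j) T' (BB G (AA x) j D)).
        { rewrite <- E'; exists D; auto. }
        destruct H3 as [D' [H3 [H4 H5]]]; apply IH2 in H5; auto; subst D'.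
        unfold sbit in H4; rewrite H2 in H4 by (simpl; auto).
        apply N; symmetry; now apply decb_true. }
    split; auto; intros i Hi0; destruct (Nat.eq_dec i (S j)) as [->|]; auto.
    apply IH1; lia.
Qed.

Theorem theorem5p1 (n : lenat) (hn : match n with Fin m => 1 <= m | Omega => True end)
  (C : Pt -> Prop) (hCX : forall x, C x -> inX n x) (hC : comeager_in (inX n) C) :
  borel_reducible (inX n) (F n) C (F n).
Proof.
  assert (H0 : lt_ln 0 n) by (destruct n; simpl; auto).
  destruct hC as [Us [HU HC]].
  destruct (mutually_generic_exists n Us H0 HU) as [G HG].
  exists (red n Us G); split; [|split].
  - intros x Hx; apply HC; [now apply red_inX|]; intros k; now apply red_generic.
  - intros B HB; exists (fun x => B (red n Us G x)); split; [|tauto].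
    apply borel_preimage; auto; intros; apply borel_red, HG.
  - intros x y Hx Hy; rewrite !F_AA by auto using red_inX; split; intros E j.
    + destruct (classic (lt_ln j n)) as [Hj|Hj].
      * rewrite !(AA_red n) by auto.
        now replace (AA y) with (AA x) by (apply functional_extensionality_dep; auto).
      * rewrite (AA_beyond n (red n Us G x)), (AA_beyond n (red n Us G y));
          auto using red_inX.
    + destruct (classic (lt_ln j n)) as [Hj|Hj].
      * destruct (AA_reflects n Us G x y Hx Hy HG E j Hj) as [H _]; auto.
      * now rewrite (AA_beyond n x), (AA_beyond n y).
Qed.
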